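(* Let $N$ be a Filiform nilpotent group of Hirsch length $h\ge3$. Then $\mathrm{F}_N(n)\approx(\log(n))^h$. In particular, if $N$ is the $3$-dimensional integral Heisenberg group, then $\mathrm{F}_N(n)\approx(\log(n))^3$.
   Context: $\mathbb{N}=\{1,2,3,\dots\}$. $\gamma_1(N)=N$, $\gamma_i(N)=[\gamma_{i-1}(N),N]$; the step length of a nilpotent group $N$ is the least natural number $c$ with $\gamma_{c+1}(N)=\{1\}$. A Filiform nilpotent group is a torsion free, finitely generated nilpotent group of Hirsch length $h\ge3$ and step length $h-1$. For a finitely generated group $G$ and $g\in G\setminus\{1\}$ let $\mathrm{D}_G(g)=\min\{|Q| : \varphi:G\to Q \text{ is a group homomorphism}, |Q|<\infty, \varphi(g)\neq 1\}$. For a residually finite group $G$ (finitely generated nilpotent groups are such) with finite generating set $S$ and word length $\|\cdot\|_S$, let $\mathrm{F}_{G,S}(n)=\max\{\mathrm{D}_G(g) : g\in G\setminus\{1\}, \|g\|_S\le n\}$. For nondecreasing functions $f,g$ of $n\in\mathbb{N}$, $f\precsim g$ means there is $C>0$ with $f(n)\le C\,g(Cn)$ for all $n$; $f\approx g$ means $f\precsim g$ and $g\precsim f$. Up to $\approx$, $\mathrm{F}_{G,S}$ is independent of $S$ and is written $\mathrm{F}_G$. *)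

(* Defs.v *)
From HB Require Import structures.
From mathcomp Require Import all_boot all_order fingroup all_algebra.
From mathcomp Require Import all_classical all_reals all_analysis.

Set Implicit Arguments.
Unset Strict Implicit.
Unset Printing Implicit Defensive.

Import Order.TTheory GRing.Theory Num.Theory.

Local Open Scope classical_set_scope.
Local Open Scope group_scope.

Definition is_subgroup (G : groupType) (H : set G) : Prop :=
  H 1 /\ (forall x y, H x -> H y -> H (x / y)).

Definition subgroup_gen (G : groupType) (A : set G) : set G :=
  smallest (@is_subgroup G) A.

Definition commutator_subgroup (G : groupType) (H K : set G) : set G :=
  subgroup_gen [set z | exists x y, [/\ H x, K y & z = [~ x, y]]].

Definition normal_subgroup (G : groupType) (K H : set G) : Prop :=
  [/\ is_subgroup K, K `<=` H & forall x k, H x -> K k -> K (k ^ x)].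

Definition generates (G : groupType) (S : seq G) : Prop :=
  subgroup_gen [set` S] = setT.

Definition finitely_generated (G : groupType) : Prop :=
  exists S : seq G, generates S.

Definition torsion_free (G : groupType) : Prop :=
  forall (x : G) (n : nat), (0 < n)%N -> x ^+ n = 1 -> x = 1.

(** Indexed from 1: the value at 0 is never used. *)
Fixpoint lower_central (G : groupType) (i : nat) : set G :=
  match i with
  | (_.+1 as i').+1 => commutator_subgroup (lower_central i') setT
  | _ => setT
  end.
Arguments lower_central G i : clear implicits.

Definition nilpotent_group (G : groupType) : Prop :=
  exists c : nat, lower_central G c.+1 = [set 1].

Definition has_step_length (G : groupType) (c : nat) : Prop :=
  [/\ (0 < c)%N, lower_central G c.+1 = [set 1] &
      forall b, (0 < b)%N -> lower_central G b.+1 = [set 1] -> (c <= b)%N].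

(** [hirsch_length_of H h]: the subgroup [H] has a subnormal series with cyclic
    factors of which exactly [h] are infinite. In the constructors the coset
    [x K] generates [H / K]; [h] does not depend on the series. *)
Inductive hirsch_length_of (G : groupType) : set G -> nat -> Prop :=
| hirsch_trivial : hirsch_length_of [set 1] 0
| hirsch_finite (H K : set G) (x : G) (h : nat) :
    is_subgroup H -> normal_subgroup K H -> H = subgroup_gen (x |` K) ->
    (exists2 n, (0 < n)%N & K (x ^+ n)) ->
    hirsch_length_of K h -> hirsch_length_of H h
| hirsch_infinite (H K : set G) (x : G) (h : nat) :
    is_subgroup H -> normal_subgroup K H -> H = subgroup_gen (x |` K) ->
    (forall n, (0 < n)%N -> ~ K (x ^+ n)) ->
    hirsch_length_of K h -> hirsch_length_of H h.+1.

Definition has_hirsch_length (G : groupType) (h : nat) : Prop :=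
  @hirsch_length_of G setT h.

Definition filiform (G : groupType) (h : nat) : Prop :=
  [/\ torsion_free G, finitely_generated G & nilpotent_group G] /\
  [/\ (3 <= h)%N, has_hirsch_length G h & has_step_length G h.-1].

(** The least and greatest elements of a set of natural numbers; the value is 0
    when there is none. *)
Definition nat_min (A : set nat) : nat := xget 0%N (A `&` lbound A).
Definition nat_max (A : set nat) : nat := xget 0%N (A `&` ubound A).

Definition word_length (G : groupType) (S : seq G) (g : G) : nat :=
  nat_min [set n | exists w : seq G,
    [/\ size w = n, {in w, forall x, (x \in S) || (x^-1 \in S)} &
        \prod_(x <- w) x = g]].

(** D_G(g); the value is 0 if no finite quotient of [G] separates [g] from 1. *)
Definition divisibility (G : groupType) (g : G) : nat :=
  nat_min [set q | exists (Q : finGroupType) (phi : {multiplicative G -> Q}),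
    #|Q| = q /\ phi g <> 1].

(** F_{G,S}(n), intended for a finite generating set [S] of a residually finite
    group: the maximum exists as soon as some [g <> 1] has length at most [n]. *)
Definition residual_finiteness (G : groupType) (S : seq G) (n : nat) : nat :=
  nat_max [set divisibility g | g in [set g | g <> 1 /\ (word_length S g <= n)%N]].

(** Growth functions are defined on the natural numbers [n >= 1], so the constant
    in the argument is a natural number. *)
Definition growth_le (R : realType) (f g : nat -> R) : Prop :=
  exists2 C : nat, (0 < C)%N &
    forall n : nat, (0 < n)%N -> (f n <= C%:R * g (C * n)%N)%R.

Definition growth_eq (R : realType) (f g : nat -> R) : Prop :=
  growth_le f g /\ growth_le g f.

Definition unitriangular (n : nat) (A : 'M[int]_n) : bool :=
  [forall i : 'I_n, forall j : 'I_n, (j <= i)%N ==> (A i j == (i == j)%:R)%R].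

Definition heisenberg := {A : 'M[int]_3 | unitriangular A}.

HB.instance Definition _ := Choice.on heisenberg.

Definition heis_mx (a b c : int) : 'M[int]_3 :=
  (\matrix_(i < 3, j < 3)
    (nth [::] [:: [:: 1; a; c]; [:: 0; 1; b]; [:: 0; 0; 1]] i)`_j)%R.

Lemma heis_mx_unitriangular (a b c : int) : unitriangular (heis_mx a b c).
Proof.
apply/forallP => -[[|[|[|i]]] hi] //; apply/forallP => -[[|[|[|j]]] hj] //;
  by rewrite mxE.
Qed.

Lemma unitriangular3E (A : 'M[int]_3) : unitriangular A ->
  A = heis_mx (A (inord 0) (inord 1)) (A (inord 1) (inord 2))
              (A (inord 0) (inord 2)).
Proof.
move=> /forallP hA; apply/matrixP => i j; rewrite mxE.
have := hA i => /forallP/(_ j).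
have e (k : nat) (hk : (k < 3)%N) : inord k = Ordinal hk.
  by apply: val_inj; rewrite /= inordK.
rewrite !e; case: i j => [[|[|[|i]]] hi] // [[|[|[|j]]] hj] //=; try by move/eqP.
all: by move=> _; congr (A _ _); exact: val_inj.
Qed.

Lemma heis_mxM (a b c a' b' c' : int) :
  (heis_mx a b c *m heis_mx a' b' c' =
   heis_mx (a + a') (b + b') (c + c' + a * b'))%R.
Proof.
apply/matrixP => i j; rewrite !mxE !big_ord_recl big_ord0 !mxE.
case: i j => [[|[|[|i]]] hi] // [[|[|[|j]]] hj] //=.
all: rewrite ?(mul0r, mulr0, mul1r, mulr1, addr0, add0r) //.
all: by [rewrite addrC | rewrite addrA addrC addrA].
Qed.

Lemma heis_mx0 : heis_mx 0 0 0 = 1%:M%R.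
Proof.
by apply/matrixP => -[[|[|[|i]]] hi] // [[|[|[|j]]] hj] //; rewrite !mxE.
Qed.

Lemma unitriangularM (A B : 'M[int]_3) :
  unitriangular A -> unitriangular B -> unitriangular (A *m B)%R.
Proof.
by move=> /unitriangular3E -> /unitriangular3E ->;
  rewrite heis_mxM heis_mx_unitriangular.
Qed.

Lemma unitriangular1 : unitriangular (1%:M%R : 'M[int]_3).
Proof. by rewrite -heis_mx0 heis_mx_unitriangular. Qed.

Lemma mul_unitriangular_inv (A : 'M[int]_3) : unitriangular A ->
  exists2 B, unitriangular B & (B *m A = 1%:M)%R.
Proof.
move=> /unitriangular3E ->; set a := A _ _; set b := A _ _; set c := A _ _.
exists (heis_mx (- a) (- b) (a * b - c))%R; first exact: heis_mx_unitriangular.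
by rewrite heis_mxM !addNr subrK mulNr addrN heis_mx0.
Qed.

Lemma unitriangular_unit (A : 'M[int]_3) : unitriangular A -> (A \in unitmx)%R.
Proof. by move=> /mul_unitriangular_inv[B _ /mulmx1_unit[]]. Qed.

Lemma unitriangularV (A : 'M[int]_3) :
  unitriangular A -> unitriangular (invmx A)%R.
Proof.
move=> hA; have [B hB BA] := mul_unitriangular_inv hA.
by rewrite -[invmx A]mul1mx -BA mulmxK // unitriangular_unit.
Qed.

Definition heis_mul (x y : heisenberg) : heisenberg :=
  Sub (val x *m val y)%R (unitriangularM (valP x) (valP y)).
Definition heis_one : heisenberg := Sub 1%:M%R unitriangular1.
Definition heis_inv (x : heisenberg) : heisenberg :=
  Sub (invmx (val x))%R (unitriangularV (valP x)).

Lemma heis_mulA : associative heis_mul.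
Proof. by move=> x y z; apply: val_inj; rewrite /= mulmxA. Qed.
Lemma heis_mul1 : left_id heis_one heis_mul.
Proof. by move=> x; apply: val_inj; rewrite /= mul1mx. Qed.
Lemma heis_mul1r : right_id heis_one heis_mul.
Proof. by move=> x; apply: val_inj; rewrite /= mulmx1. Qed.
Lemma heis_mulV : left_inverse heis_one heis_inv heis_mul.
Proof.
by move=> x; apply: val_inj; rewrite /= mulVmx ?unitriangular_unit ?(valP x).
Qed.
Lemma heis_mulVr : right_inverse heis_one heis_inv heis_mul.
Proof.
by move=> x; apply: val_inj; rewrite /= mulmxV ?unitriangular_unit ?(valP x).
Qed.

HB.instance Definition _ :=
  isGroup.Build heisenberg heis_mulA heis_mul1 heis_mul1r heis_mulV heis_mulVr.

(* Main.v *)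
From HB Require Import structures.
Require Import Defs.
From mathcomp Require Import all_boot all_order fingroup all_algebra.
From mathcomp Require Import all_classical all_reals all_analysis.
From mathcomp Require Import cyclic zify ring lra.

(** Let [N] be filiform of Hirsch length [h], hence of class [c = h - 1].

    Upper bound. Take a subnormal series of [N] with cyclic factors, [h] of them
    infinite. Counting along it, the subgroup generated by the [m]-th powers has
    index at most a constant times [m ^ h] ([hirsch_left_cover]), so it is enough
    to show that a nontrivial [g] of length [n] lies outside such a
    subgroup for some [m] of order [ln n] ([separating_exponent]). This is done
    with polynomial functions to the integers, that is, functions killed by
    iterated differences. Finitely many of them separate a subgroup of finite
    index from 1 ([hirsch_poly_separated]); they are built along the series, and
    the point is that a polynomial on a subgroup [M] extends to [M T] when [T]
    normalizes [M] ([wpoly_lt_extend]), because conjugation in a nilpotent group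
    is unipotent on polynomials ([wpoly_lt_conj_sub]). A polynomial takes on words
    of length [n] values bounded by a power of [n] ([word_poly_bound]), and
    modulo [j] it is invariant under powers of exponent a constant times [j]
    ([poly_lt_power_mod]). A nonzero integer [a] is not divisible by some [j] of
    order [ln |a|], because the least common multiple of the first [x] integers
    is at least [2 ^ x / (x + 1)] ([exp2_le_lcm_upto]).

    Lower bound. Let [z] be a nontrivial commutator of length [c]; it has infinite
    order. If a finite quotient does not kill [z ^+ L], where [L] is the least
    common multiple of [1, ..., m], then the image of [z] has order [q > m].
    Commuting with the remaining entries of [z] maps the [i]-th term of the lower
    central series homomorphically to the centre. In the quotient, each of the
    [c] factors of that series therefore has at least [q] elements, and the first
    one even [q ^ 2]
    ([card_image_lower]). The quotient has at least [q ^ c.+1], hence more than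
    [m ^ h], elements, while [z ^+ L] has length at most a constant times
    [L <= 4 ^ m] when [m] is a power of two ([lcm_upto_exp2]). *)

Set Implicit Arguments.
Unset Strict Implicit.
Unset Printing Implicit Defensive.

Import Order.TTheory GRing.Theory Num.Theory.

(** * Least common multiples of the first integers *)

Definition lcm_upto (n : nat) : nat := \big[lcmn/1]_(i < n) i.+1.

Lemma dvdn_lcm_upto n i : 0 < i <= n -> i %| lcm_upto n.
Proof.
case: i => // i /= lt_in.
by rewrite /lcm_upto (bigD1 (Ordinal lt_in)) //= dvdn_lcml.
Qed.

Lemma lcm_upto_dvd n a : (forall i, 0 < i <= n -> i %| a) -> lcm_upto n %| a.
Proof.
move=> a_div; apply: (big_ind (fun x => x %| a)) => //=.
- by move=> x y xa ya; rewrite dvdn_lcm xa.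
- by move=> i _; apply: a_div; rewrite /= ltn_ord.
Qed.

Lemma lcm_upto_gt0 n : 0 < lcm_upto n.
Proof.
apply: (big_ind (fun x => 0 < x)) => // x y x0 y0.
by rewrite lcmn_gt0 x0.
Qed.

(** The numbers [1 / (k * 'C(n, k))] form Leibniz's harmonic triangle: each is a
    difference of two entries of the preceding column, so by induction on [k]
    all are integral combinations of [1 / 1, ..., 1 / n]. *)
Lemma mul_bin_dvd_lcm n k : 0 < k <= n -> k * 'C(n, k) %| lcm_upto n.
Proof.
elim: k n => // k IHk n /andP[_ lt_kn].
case: k IHk lt_kn => [|k] IHk lt_kn.
  by rewrite mul1n bin1 dvdn_lcm_upto ?lt_kn ?leqnn.
case: n lt_kn => // n lt_kn.
have /dvdnP[c2 e2] := IHk n.+1 (ltnW lt_kn : 0 < k.+1 <= n.+1).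
have /dvdnP[c1 e1] : k.+1 * 'C(n, k.+1) %| lcm_upto n.+1.
  apply: dvdn_trans (IHk n lt_kn) _.
  apply: lcm_upto_dvd => i /andP[i0 le_in].
  by rewrite dvdn_lcm_upto // i0 ltnW.
apply/dvdnP; exists (c1 - c2).
rewrite -mul_bin_diag.
have e3 : k.+1 * 'C(n, k.+1) = (n - k) * 'C(n, k).
  by rewrite -mul_bin_left.
rewrite -mul_bin_diag in e2.
apply/eqP; rewrite -(eqn_pmul2l (ltn0Sn k)); apply/eqP.
rewrite mulnCA [_ * (n.+1 * _)]mulnCA e3 mulnBl.
set X := 'C(n, k) in e2 e3 *; set L := lcm_upto _ in e1 e2 *.
rewrite e3 in e1.
have -> : c1 * (n.+1 * ((n - k) * X)) = n.+1 * L by rewrite e1; lia.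
have -> : c2 * (n.+1 * ((n - k) * X)) = (n - k) * L by rewrite e2; lia.
by rewrite -mulnBl; congr (_ * _); lia.
Qed.

(** Every binomial coefficient ['C(n, k)] divides [lcm_upto n], and [2 ^ n] is
    their sum over [k]. *)
Lemma exp2_le_lcm_upto n : 2 ^ n <= n.+1 * lcm_upto n.
Proof.
rewrite -[2]/(1 + 1) expnDn.
apply: leq_trans (_ : \sum_(i < n.+1) lcm_upto n <= _); last first.
  by rewrite sum_nat_const card_ord.
apply: leq_sum => -[[|k] /= lt_kn] _; rewrite !exp1n !muln1.
  by rewrite bin0 lcm_upto_gt0.
apply: leq_trans (leq_pmull _ (ltn0Sn k)) _.
by rewrite dvdn_leq ?lcm_upto_gt0 // mul_bin_dvd_lcm.
Qed.

(** Legendre's formula with a summation range that depends only on an upper bound,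
    so that the formulas for [n`!] and [n.*2`!] can be compared termwise. *)
Lemma logn_fact_widen p n N : prime p -> n <= N ->
  logn p n`! = \sum_(1 <= k < N.+1) n %/ p ^ k.
Proof.
move=> p_pr le_nN; rewrite logn_fact // [RHS](big_cat_nat (n := n.+1)) //=.
rewrite [X in _ + X]big_nat_cond [X in _ + X]big1 ?addn0 // => i.
move=> /andP[/andP[lt_ni _] _]; apply: divn_small.
by rewrite (leq_trans lt_ni) // ltnW // ltn_expl // prime_gt1.
Qed.

(** In Legendre's formula for ['C(2 n, n)] the terms are
    [2 n %/ p ^ k - 2 (n %/ p ^ k)], all nonnegative; the term [k = e] is 1. *)
Lemma prime_dvd_central_bin n p e :
  prime p -> n < p ^ e <= n.*2 -> p %| 'C(n.*2, n).
Proof.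
move=> p_pr /andP[lt_n le_n].
have e_gt0 : 0 < e by case: e lt_n le_n => //; rewrite expn0; lia.
have le_en : e <= n.*2 by rewrite (leq_trans _ le_n) // ltnW // ltn_expl // prime_gt1.
have le_nn : n <= n.*2 by rewrite -addnn leq_addr.
have Cgt0 : 0 < 'C(n.*2, n) by rewrite bin_gt0.
have := congr1 (logn p) (bin_fact le_nn).
rewrite -[X in X - n]addnn addKn !lognM ?muln_gt0 ?fact_gt0 //.
rewrite !(@logn_fact_widen p _ n.*2) // addnn -[X in _ + X]mul2n big_distrr /= => eqC.
suff: \sum_(1 <= k < n.*2.+1) 2 * (n %/ p ^ k) <
      \sum_(1 <= k < n.*2.+1) n.*2 %/ p ^ k.
  rewrite -eqC -[X in X < _]add0n ltn_add2r.
  by rewrite logn_gt0 mem_primes p_pr Cgt0.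
have le2 k : 2 * (n %/ p ^ k) <= n.*2 %/ p ^ k.
  by rewrite leq_divRL ?expn_gt0 ?prime_gt0 // -mulnA -mul2n leq_mul2l leq_divM.
rewrite (big_cat_nat (n := e)) //=; last by rewrite ltnW.
rewrite [X in _ < X](big_cat_nat (n := e)) //=; last by rewrite ltnW.
rewrite -addnS leq_add //; first exact: leq_sum.
rewrite big_ltn // [X in _ < X]big_ltn // -addSn leq_add //; last exact: leq_sum.
by rewrite divn_small // muln0 divn_gt0 ?expn_gt0 ?prime_gt0.
Qed.

(** Passing from [n] to [2 n] raises the exponent of a prime in the least common
    multiple by at most one, and only when some power of that prime lies in
    the interval from [n] to [2 n]; that prime divides the central binomial. *)
Lemma lcm_upto_double n : lcm_upto n.*2 %| lcm_upto n * 'C(n.*2, n).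
Proof.
apply: lcm_upto_dvd => i /andP[i0 le_i].
apply/dvdn_partP => // p; rewrite mem_primes => /and3P[p_pr _ _].
rewrite p_part; set e := logn p i.
have le_e : p ^ e <= n.*2 by rewrite (leq_trans _ le_i) // dvdn_leq // pfactor_dvdnn.
have [le_en|lt_ne] := leqP (p ^ e) n.
  by rewrite dvdn_mulr // dvdn_lcm_upto // expn_gt0 prime_gt0.
have := prime_dvd_central_bin p_pr (_ : n < p ^ e <= n.*2); rewrite lt_ne => /(_ le_e) pC.
case: e lt_ne le_e => [|e] lt_ne le_e; first by rewrite dvd1n.
rewrite expnSr dvdn_mul // dvdn_lcm_upto // expn_gt0 prime_gt0 //=.
have := prime_gt1 p_pr; rewrite expnSr in le_e; nia.
Qed.

(** By [lcm_upto_double], doubling [n] costs at most the factor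
    ['C(2 n, n) <= 4 ^ n]. *)
Lemma lcm_upto_exp2 k : 4 * lcm_upto (2 ^ k) <= 4 ^ (2 ^ k).
Proof.
elim: k => [|k IHk]; first by rewrite expn0 /lcm_upto big_ord1.
set n := 2 ^ k in IHk *.
have -> : 2 ^ k.+1 = n.*2 by rewrite expnS mul2n.
have : lcm_upto n.*2 <= lcm_upto n * 'C(n.*2, n).
  by rewrite dvdn_leq ?lcm_upto_double // muln_gt0 lcm_upto_gt0 bin_gt0 -addnn leq_addr.
have : 'C(n.*2, n) <= 4 ^ n.
  have lt_n : n < n.*2.+1 by rewrite ltnS -addnn leq_addr.
  rewrite -[4]/(2 ^ 2) -expnM mul2n -[2 in X in _ <= X]/(1 + 1) expnDn.
  by rewrite (bigD1 (Ordinal lt_n)) //= !exp1n !muln1 leq_addr.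
rewrite -addnn expnD; nia.
Qed.

Local Open Scope classical_set_scope.
Local Open Scope group_scope.

(** * Subgroups and the lower central series *)

Section Subgroups.
Variable G : groupType.
Implicit Types (H K A : set G) (x y t : G).

Lemma subgroup1 H : is_subgroup H -> H 1.
Proof. by case. Qed.

Lemma subgroupV H x : is_subgroup H -> H x -> H x^-1.
Proof. by move=> [H1 HF] Hx; rewrite -div1g; apply: HF. Qed.

Lemma subgroupM H x y : is_subgroup H -> H x -> H y -> H (x * y).
Proof.
by move=> sH Hx Hy; rewrite -[y]invgK; apply: sH.2 => //; apply: subgroupV.
Qed.

Lemma subgroupX H x n : is_subgroup H -> H x -> H (x ^+ n).
Proof.
move=> sH Hx; elim: n => [|n IHn]; first exact: subgroup1.
by rewrite expgS; apply: subgroupM.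
Qed.

Lemma subgroupMr H x y : is_subgroup H -> H y -> H (x * y) -> H x.
Proof.
by move=> sH Hy Hxy; rewrite -(mulgK y x); apply: sH.2.
Qed.

Lemma is_subgroup_intro H : H 1 -> (forall x y, H x -> H y -> H (x * y)) ->
  (forall x, H x -> H x^-1) -> is_subgroup H.
Proof. by move=> H1 HM HV; split=> // x y Hx Hy; apply: HM => //; apply: HV. Qed.

Lemma subgroup_gen_subgroup A : is_subgroup (subgroup_gen A).
Proof.
split=> [H [sH _]|x y Hx Hy H sHA]; first exact: subgroup1.
by apply: sHA.1.2; [apply: Hx | apply: Hy].
Qed.

Lemma subgroup_gen_sub A H : is_subgroup H -> A `<=` H -> subgroup_gen A `<=` H.
Proof. by move=> sH AH x; apply. Qed.

Lemma sub_subgroup_gen A : A `<=` subgroup_gen A.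
Proof. by move=> x Ax H [_]; apply. Qed.

Lemma subgroup_genS A B : A `<=` B -> subgroup_gen A `<=` subgroup_gen B.
Proof.
move=> AB; apply: subgroup_gen_sub; first exact: subgroup_gen_subgroup.
exact: subset_trans AB (@sub_subgroup_gen B).
Qed.

Lemma setT_subgroup : is_subgroup [set: G].
Proof. by []. Qed.

Lemma subgroup_gen_conj A H :
  (forall x t, A x -> H t -> A (x ^ t)) ->
  forall x t, subgroup_gen A x -> H t -> subgroup_gen A (x ^ t).
Proof.
move=> AJ x t + Ht.
apply: (@subgroup_gen_sub _ [set y | subgroup_gen A (y ^ t)]).
  have sA := subgroup_gen_subgroup A.
  apply: is_subgroup_intro => /= [|y z|y]; first by rewrite conj1g; apply: subgroup1.
    by rewrite conjMg; apply: subgroupM.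
  by rewrite conjVg; apply: subgroupV.
by move=> y Ay /=; apply: sub_subgroup_gen; apply: AJ.
Qed.

Local Notation gamma := (lower_central G).

Lemma lower_central_subgroup i : is_subgroup (gamma i).
Proof.
by case: i => [|[|i]] /=; [exact: setT_subgroup..|exact: subgroup_gen_subgroup].
Qed.

Lemma lower_central_comm i x y : gamma i x -> gamma i.+1 [~ x, y].
Proof.
case: i => // i gx; apply: sub_subgroup_gen.
by exists x, y; split.
Qed.

Lemma lower_central_commV i x y : gamma i x -> gamma i.+1 [~ y, x].
Proof.
move=> gx; rewrite -invgR; apply: subgroupV (lower_central_subgroup _) _.
exact: lower_central_comm.
Qed.

Lemma lower_centralS i : gamma i.+1 `<=` gamma i.
Proof.
elim: i => [//|[//|i] IHi]; apply: subgroup_genS => z [x [y [gx _ ->]]].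
by exists x, y; split=> //; apply: IHi.
Qed.

Lemma lower_central_le i j : (i <= j)%N -> gamma j `<=` gamma i.
Proof.
move=> /subnK <-; elim: (j - i)%N => // k IHk.
by move=> x gx; apply/IHk/lower_centralS; rewrite -addSn.
Qed.

Lemma lower_centralJ i x y : gamma i x -> gamma i (x ^ y).
Proof.
move=> gx; rewrite -[x ^ y](mulVKg x) -commgEl.
apply: subgroupM (lower_central_subgroup _) (gx) _.
by apply: lower_centralS; apply: lower_central_comm.
Qed.

Lemma lower_central_trivial c i : gamma c.+1 = [set 1] -> (c < i)%N ->
  forall x, gamma i x -> x = 1.
Proof. by move=> g1 lt_ci x /(lower_central_le lt_ci); rewrite g1. Qed.

End Subgroups.

(** * Polynomial functions on a nilpotent group *)

Section Polynomials.
Variable G : groupType.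
Implicit Types (H K M T : set G) (f g : G -> int) (s t x : G).

Definition ldiff s f : G -> int := fun x => (f (s * x)%g - f x)%R.

(** The bound on the degree is strict so that [d = 0] means the zero function, the
    base of all inductions on the degree. *)
Fixpoint poly_lt K (d : nat) f : Prop :=
  if d is d'.+1 then forall s, K s -> poly_lt K d' (ldiff s f)
  else forall x, K x -> f x = 0%R.

Lemma poly_ltS K d f : is_subgroup K -> poly_lt K d f -> poly_lt K d.+1 f.
Proof.
move=> sK; elim: d f => [|d IHd] f pf s Ks /=; last by apply: IHd; apply: pf.
by move=> x Kx; rewrite /ldiff !pf //; apply: subgroupM.
Qed.

Lemma poly_lt_le K d d' f : is_subgroup K -> (d <= d')%N ->
  poly_lt K d f -> poly_lt K d' f.
Proof.
move=> sK /subnK <-; elim: (d' - d)%N => // k IHk pf.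
by rewrite addSn; apply: poly_ltS => //; apply: IHk.
Qed.

Lemma poly_lt_sub K K' d f : K' `<=` K -> poly_lt K d f -> poly_lt K' d f.
Proof.
move=> K'K; elim: d f => [|d IHd] f /= pf x K'x; first exact/pf/K'K.
exact/IHd/pf/K'K.
Qed.

(** Newton interpolation along the powers of [s]: the coefficients are the iterated
    differences of [f] at [x]. *)
Lemma poly_lt_iter K d f s x : is_subgroup K -> K s -> K x -> poly_lt K d f ->
  exists b : nat -> int, forall m,
    f (s ^+ m * x)%g = (\sum_(j < d) b j * ('C(m, j))%:R)%R.
Proof.
move=> sK Ks Kx; elim: d f => [|d IHd] f pf.
  exists (fun=> 0%R) => m; rewrite big_ord0 pf //.
  by apply: subgroupM => //; apply: subgroupX.
have [b hb] := IHd _ (pf s Ks).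
exists (fun j => if j is j'.+1 then b j' else f x) => m.
rewrite big_ord_recl /= bin0 mulr1.
elim: m => [|m IHm].
  rewrite mul1g big1 ?addr0 // => i _; by rewrite bin0n mulr0.
have := hb m; rewrite /ldiff mulgA -expgS => /eqP; rewrite subr_eq => /eqP ->.
rewrite IHm addrCA; congr (_ + _)%R; rewrite -big_split /=.
by apply: eq_bigr => i _; rewrite binS natrD mulrDr addrC.
Qed.

(** From [j * 'C(M, j) = M * 'C(M - 1, j - 1)], and [j] divides [d`!]. *)
Lemma fact_dvd_bin d m j : (0 < j <= d)%N -> (m %| 'C(d`! * m, j))%N.
Proof.
case: j => // j /= le_jd.
have [->|m_gt0] := posnP m; first by rewrite muln0 bin0n.
have /dvdnP[q eq] : (j.+1 %| d`!)%N by rewrite dvdn_fact.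
apply/dvdnP; exists (q * 'C((d`! * m).-1, j))%N.
have := mul_bin_diag (d`! * m) j.
rewrite {1}eq => e; apply/eqP; rewrite -(eqn_pmul2l (ltn0Sn j)) -e; apply/eqP.
lia.
Qed.

(** A polynomial function is periodic modulo [m] along powers, with a period that is
    linear in [m]: this is what keeps the separating exponents logarithmic. *)
Lemma poly_lt_power_mod K d f s x m : is_subgroup K -> K s -> K x ->
  poly_lt K d f -> (m%:Z %| (f (s ^+ (d`! * m)%N * x)%g - f x)%R)%Z.
Proof.
move=> sK Ks Kx pf; have [b hb] := poly_lt_iter sK Ks Kx pf.
have := hb 0%N; rewrite mul1g => ->; rewrite hb -sumrB.
apply: rpred_sum => -[[|j] lt_jd] _ /=; first by rewrite !bin0 subrr dvdz0.
rewrite bin0n mulr0 subr0; apply: dvdz_mull.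
by rewrite natz dvdzE /=; apply: fact_dvd_bin; apply: ltnW.
Qed.

Variable c : nat.
Hypothesis nilG : lower_central G c.+1 = [set 1].
Local Notation gamma := (lower_central G).

(** Weighted degree less than [d], where a difference by an element of [gamma i]
    lowers the degree by [i]. The truncated subtraction is intended: once the
    weights reach [d], the difference vanishes. *)
Inductive wpoly_lt K : nat -> (G -> int) -> Prop :=
| wpoly_lt0 f : (forall x, K x -> f x = 0%R) -> wpoly_lt K 0 f
| wpoly_ltS d f : (forall i s, (0 < i)%N -> K s -> gamma i s ->
    wpoly_lt K (d.+1 - i) (ldiff s f)) -> wpoly_lt K d.+1 f.

Lemma wpoly_lt_ldiff K d f i s : is_subgroup K -> wpoly_lt K d f ->
  (0 < i)%N -> K s -> gamma i s -> wpoly_lt K (d - i) (ldiff s f).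
Proof.
move=> sK pf i0 Ks gs; case: pf => [g g0|d' g pg]; last exact: pg.
apply: wpoly_lt0 => x Kx; rewrite /ldiff !g0 ?subrr //; exact: subgroupM.
Qed.

Lemma wpoly_lt_zero K d f : is_subgroup K ->
  (forall x, K x -> f x = 0%R) -> wpoly_lt K d f.
Proof.
move=> sK; elim/ltn_ind: d f => -[|d] IHd f f0; first exact: wpoly_lt0.
apply: wpoly_ltS => i s i0 Ks _; apply: IHd; first by lia.
by move=> x Kx; rewrite /ldiff !f0 ?subrr //; apply: subgroupM.
Qed.

Lemma wpoly_lt_ext K d f g : is_subgroup K -> (forall x, K x -> f x = g x) ->
  wpoly_lt K d f -> wpoly_lt K d g.
Proof.
move=> sK fg pf; elim: pf g fg => {d f} [f f0|d f _ IH] g fg.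
  by apply: wpoly_lt0 => x Kx; rewrite -fg ?f0.
apply: wpoly_ltS => i s i0 Ks gs; apply: (IH i s) => // x Kx.
by rewrite /ldiff !fg //; apply: subgroupM.
Qed.

Lemma wpoly_lt_succ K d f : is_subgroup K -> wpoly_lt K d f -> wpoly_lt K d.+1 f.
Proof.
move=> sK; elim/ltn_ind: d f => d IHd f pf.
apply: wpoly_ltS => i s i0 Ks gs.
have := wpoly_lt_ldiff sK pf i0 Ks gs.
have [le_id|lt_di] := leqP i d.
  by rewrite subSn //; apply: IHd; lia.
have [-> ->] : (d - i = 0 /\ d.+1 - i = 0)%N by lia.
by [].
Qed.

Lemma wpoly_lt_le K d d' f : is_subgroup K -> (d <= d')%N ->
  wpoly_lt K d f -> wpoly_lt K d' f.
Proof.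
move=> sK /subnK <-; elim: (d' - d)%N => // k IHk pf.
by rewrite addSn; apply: wpoly_lt_succ => //; apply: IHk.
Qed.

Lemma wpoly_ltD K d f g : is_subgroup K -> wpoly_lt K d f -> wpoly_lt K d g ->
  wpoly_lt K d (fun x => f x + g x)%R.
Proof.
move=> sK; elim/ltn_ind: d f g => d IHd f g pf pg.
case: d IHd pf pg => [|d] IHd pf pg.
  have z h : wpoly_lt K 0 h -> forall x, K x -> h x = 0%R.
    by move=> ph; inversion ph.
  by apply: wpoly_lt0 => x Kx; rewrite !z.
apply: wpoly_ltS => i s i0 Ks gs.
have pfs := wpoly_lt_ldiff sK pf i0 Ks gs.
have pgs := wpoly_lt_ldiff sK pg i0 Ks gs.
apply: (wpoly_lt_ext sK _ (IHd _ _ _ _ pfs pgs)); last by lia.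
by move=> x Kx; rewrite /ldiff; ring.
Qed.

Lemma wpoly_lt_conj K d f t : is_subgroup K -> (forall x, K x -> K (x ^ t)) ->
  wpoly_lt K d f -> wpoly_lt K d (fun x => f (x ^ t)).
Proof.
move=> sK KJ; elim: d f / => [f f0|d f _ IH].
  by apply: wpoly_lt0 => x Kx; apply/f0/KJ.
apply: wpoly_ltS => i s i0 Ks gs.
apply: (wpoly_lt_ext sK _ (IH i (s ^ t) i0 (KJ _ Ks) (lower_centralJ _ gs))).
by move=> x Kx; rewrite /ldiff conjMg.
Qed.

(** Conjugation by [t] changes [s] in [gamma i] by the factor [[~ s, t]], which
    lies in [gamma i.+1]. So it fixes the leading part of a polynomial for the
    weighted degree, although not for the ordinary one; this is why weights are
    introduced. *)
Lemma wpoly_lt_conj_sub K d f t : is_subgroup K ->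
  (forall x, K x -> K (x ^ t)) -> wpoly_lt K d f ->
  wpoly_lt K d.-1 (fun x => f (x ^ t)%g - f x)%R.
Proof.
move=> sK KJ; elim/ltn_ind: d f => -[|d] IHd f pf.
  inversion pf as [? f0|]; apply: wpoly_lt0 => x Kx.
  by rewrite !f0 ?subrr //; apply: KJ.
case: d IHd pf => [|d] IHd pf /=.
  apply: wpoly_lt0 => x Kx.
  have p1 := wpoly_lt_ldiff sK pf (ltn0Sn 0) (subgroupM sK (KJ _ Kx) (subgroupV sK Kx)) I.
  inversion p1 as [? f0|]; have := f0 x Kx.
  by rewrite /ldiff mulgVK.
apply: wpoly_ltS => i s i0 Ks gs.
(* The difference by [s ^ t = s * k], with [k := [~ s, t]], is expanded as
   [D_s f + D_k (D_s f) + D_k f]; the last two terms have the lower degree. *)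
have Kk : K [~ s, t] by rewrite commgEl; apply: subgroupM (KJ _ Ks) => //; apply: subgroupV.
have gk := lower_central_comm t gs.
have ps := wpoly_lt_ldiff sK pf i0 Ks gs.
have pk := wpoly_lt_ldiff sK pf (ltn0Sn i) Kk gk.
have psk : wpoly_lt K (d.+1 - i) (fun x => ldiff s f (x ^ t)%g - ldiff s f x)%R.
  rewrite (_ : d.+1 - i = (d.+2 - i).-1)%N; last by lia.
  by apply: IHd => //; lia.
rewrite subSS in pk.
have pks : wpoly_lt K (d.+1 - i) (ldiff [~ s, t] (ldiff s f)).
  by apply: wpoly_lt_le (wpoly_lt_ldiff sK ps _ Kk gk) => //; lia.
apply: (wpoly_lt_ext sK _ (wpoly_ltD sK psk
  (wpoly_ltD sK (wpoly_lt_conj sK KJ pks) (wpoly_lt_conj sK KJ pk)))).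
move=> x Kx; rewrite /ldiff conjMg.
have -> : s ^ t = s * [~ s, t] by rewrite commgEl mulVKg.
by rewrite !mulgA; ring.
Qed.

(** An element of weight above [c] is trivial, so each nonzero difference takes away
    at most [c] from the weighted degree; the factor [c.+1] also covers [c = 0]. *)
Lemma poly_lt_wpoly K d f : is_subgroup K -> poly_lt K d f ->
  wpoly_lt K (d * c.+1) f.
Proof.
move=> sK; elim: d f => [|d IHd] f pf; first exact: wpoly_lt0.
rewrite mulSn addSn; apply: wpoly_ltS => i s i0 Ks gs.
have [le_ic|lt_ci] := leqP i c.+1.
  by apply: wpoly_lt_le (IHd _ (pf s Ks)) => //; lia.
apply: wpoly_lt_zero => // x Kx.
by rewrite (lower_central_trivial nilG (ltnW lt_ci) gs) /ldiff mul1g subrr.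
Qed.

(** A polynomial on [M] extends to [M T] by ignoring the factor in [T]. Left
    translation by [v r], for [v] in [M] and [r] in [T], carries the extension of
    [f] to that of [u |-> f (v * u ^ r^-1)], and both the translation and the
    conjugation change [f] by a function of lower weighted degree. *)
Lemma wpoly_lt_extend M T d f F : is_subgroup M -> is_subgroup T ->
  (forall x t, M x -> T t -> M (x ^ t)) ->
  (forall u t, M u -> T t -> F (u * t) = f u) ->
  wpoly_lt M d f -> poly_lt [set x | exists u t, [/\ M u, T t & x = u * t]] d F.
Proof.
move=> sM sT MJ; elim: d f F => [|d IHd] f F Ff pf /=.
  move=> _ [u [t [Mu Tt ->]]]; rewrite Ff //.
  by inversion pf as [? f0|]; apply: f0.
move=> _ [v [r [Mv Tr ->]]].
have MJr x : M x -> M (x ^ r^-1).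
  by move=> Mx; apply: MJ => //; apply: subgroupV.
apply: (IHd (fun u => f (v * u ^ r^-1)%g - f u)%R) => [u t Mu Tt|].
  rewrite /ldiff; have -> : v * r * (u * t) = v * u ^ r^-1 * (r * t).
    by rewrite conjgE invgK !mulgA mulgVK.
  by rewrite !Ff //; [apply: subgroupM (MJr _ Mu) | apply: subgroupM].
have pv := wpoly_lt_ldiff sM pf (ltn0Sn 0) Mv I.
rewrite subSS subn0 in pv.
apply: (wpoly_lt_ext sM _ (wpoly_ltD sM (wpoly_lt_conj sM MJr pv)
  (wpoly_lt_conj_sub sM MJr pf))).
by move=> x Mx; rewrite /ldiff; ring.
Qed.

End Polynomials.

(** * Power subgroups and their index *)

Section PowerSubgroups.
Variable G : groupType.
Implicit Types (H K M T : set G) (x y t : G) (R : seq G).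

Definition power_subgroup H m : set G :=
  subgroup_gen [set y | exists2 x, H x & y = x ^+ m].

Lemma power_subgroup_subgroup H m : is_subgroup (power_subgroup H m).
Proof. exact: subgroup_gen_subgroup. Qed.

Lemma power_subgroup_min H K m : is_subgroup K ->
  (forall x, H x -> K (x ^+ m)) -> power_subgroup H m `<=` K.
Proof. by move=> sK HK; apply: subgroup_gen_sub => // _ [x Hx ->]; apply: HK. Qed.

Lemma mem_power_subgroup H m x : H x -> power_subgroup H m (x ^+ m).
Proof. by move=> Hx; apply: sub_subgroup_gen; exists x. Qed.

Lemma power_subgroup_sub H m : is_subgroup H -> power_subgroup H m `<=` H.
Proof. by move=> sH; apply: power_subgroup_min => // x; apply: subgroupX. Qed.

Lemma power_subgroupS H K m : H `<=` K -> power_subgroup H m `<=` power_subgroup K m.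
Proof.
move=> HK; apply: power_subgroup_min => [|x Hx]; first exact: power_subgroup_subgroup.
by apply: mem_power_subgroup; apply: HK.
Qed.

Lemma power_subgroupJ H K m : (forall x t, H x -> K t -> H (x ^ t)) ->
  forall x t, power_subgroup H m x -> K t -> power_subgroup H m (x ^ t).
Proof.
move=> HJ; apply: subgroup_gen_conj => _ t [x Hx ->] Kt.
by exists (x ^ t); [apply: HJ | rewrite conjXg].
Qed.

Lemma power_subgroup_mul H K m n : (forall x, H x -> K (x ^+ m)) ->
  power_subgroup H (m * n) `<=` power_subgroup K n.
Proof.
move=> HK; apply: power_subgroup_min => [|x Hx]; first exact: power_subgroup_subgroup.
by rewrite expgnA; apply: mem_power_subgroup; apply: HK.
Qed.

Definition cyclic_of x : set G := [set y | exists a b : nat, y = x ^+ a / x ^+ b].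

Lemma cyclic_of_gen x : cyclic_of x x.
Proof. by exists 1%N, 0%N; rewrite divg1. Qed.

Lemma expg_div_mul x a b a' b' :
  (x ^+ a / x ^+ b) * (x ^+ a' / x ^+ b') = x ^+ (a + a') / x ^+ (b + b').
Proof.
rewrite [(b + b')%N]addnC !expgnDr invMg !mulgA; congr (_ * _).
rewrite -!mulgA; congr (_ * _).
apply: commute_sym; apply: commuteV; apply: commuteX2; exact: commute_refl.
Qed.

Lemma cyclic_of_subgroup x : is_subgroup (cyclic_of x).
Proof.
apply: is_subgroup_intro => [|_ _ [a [b ->]] [a' [b' ->]]|_ [a [b ->]]].
- by exists 0%N, 0%N; rewrite divg1.
- by exists (a + a')%N, (b + b')%N; rewrite expg_div_mul.
- by exists b, a; rewrite invgF.
Qed.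

Lemma cyclic_of_sub H x : is_subgroup H -> H x -> cyclic_of x `<=` H.
Proof.
by move=> sH Hx _ [a [b ->]]; apply: sH.2; apply: subgroupX.
Qed.

Definition set_mul M T : set G := [set x | exists u t, [/\ M u, T t & x = u * t]].

Lemma set_mul_subgroup M T : is_subgroup M -> is_subgroup T ->
  (forall x t, M x -> T t -> M (x ^ t)) -> is_subgroup (set_mul M T).
Proof.
move=> sM sT MJ.
have MJV x t : M x -> T t -> M (x ^ t^-1) by move=> Mx Tt; apply: MJ => //; apply: subgroupV.
apply: is_subgroup_intro => [|_ _ [u [t [Mu Tt ->]]] [v [r [Mv Tr ->]]]|_ [u [t [Mu Tt ->]]]].
- by exists 1, 1; split; [exact: subgroup1..|rewrite mulg1].
- exists (u * v ^ t^-1), (t * r); split; [|exact: subgroupM|].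
    by apply: subgroupM => //; apply: MJV.
  by rewrite conjgE invgK !mulgA mulgVK.
- exists (u^-1 ^ t), t^-1; split; [|exact: subgroupV|].
    by apply: MJ => //; apply: subgroupV.
  by rewrite conjgE !mulgA mulgK invMg.
Qed.

Lemma cyclic_ext_decomp H K x : is_subgroup H -> normal_subgroup K H ->
  H = subgroup_gen (x |` K) ->
  [/\ H x, forall u t, K u -> cyclic_of x t -> K (u ^ t) &
  H = set_mul K (cyclic_of x)].
Proof.
move=> sH [sK KH KJ] eH.
have Hx : H x by rewrite eH; apply: sub_subgroup_gen; left.
have KJT u t : K u -> cyclic_of x t -> K (u ^ t).
  by move=> Ku Tt; apply: KJ => //; apply: cyclic_of_sub Tt.
split=> //; rewrite predeqE => y; split=> [|[u [t [Ku Tt ->]]]]; last first.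
  by apply: subgroupM => //; [apply: KH | apply: cyclic_of_sub Tt].
rewrite [X in X y -> _]eH; apply: subgroup_gen_sub.
  by apply: set_mul_subgroup => //; apply: cyclic_of_subgroup.
move=> z [->|Kz].
  by exists 1, x; split; [exact: subgroup1|exact: cyclic_of_gen|rewrite mul1g].
exists z, 1; split=> //; last by rewrite mulg1.
by apply: subgroup1; apply: cyclic_of_subgroup.
Qed.

Definition left_cover H K R : Prop :=
  forall x, H x -> exists2 r, r \in R & exists2 k, K k & x = r * k.

(** Along the series, a factor generated by the coset of [x] costs a factor [m] when
    it is infinite, since [x ^+ m] is in the power subgroup, and a factor
    independent of [m] when it is finite. Only [h] factors depend on [m]. *)
Lemma hirsch_left_cover H h : hirsch_length_of H h ->
  is_subgroup H /\ exists k, forall m, (0 < m)%N ->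
    exists2 R, (size R <= k * m ^ h)%N & left_cover H (power_subgroup H m) R.
Proof.
(* Common to both kinds of factors: if the products of an element of the
   cyclic group of [x ^+ n] and an element of [K] are covered by [R], then
   [L] is covered by the translates of [R] by [x ^+ i], for [i < n]. *)
have step L K x n m k R : is_subgroup L -> normal_subgroup K L ->
    L = subgroup_gen (x |` K) -> (0 < n)%N -> (size R <= k)%N ->
    (forall t u, cyclic_of (x ^+ n) t -> K u -> exists2 r, r \in R & exists2 v,
       power_subgroup L m v & t * u = r * v) ->
    exists2 R', (size R' <= n * k)%N & left_cover L (power_subgroup L m) R'.
  move=> sL nK eL n0 sizeR tu.
  have [Lx KJ eqL] := cyclic_ext_decomp sL nK eL.
  exists [seq x ^+ i * r | i <- iota 0 n, r <- R].
    by rewrite size_allpairs size_iota leq_mul2l sizeR orbT.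
  move=> y Ly.
  have sT := cyclic_of_subgroup x.
  have [sK _ _] := nK.
  have : set_mul K (cyclic_of x) y^-1 by rewrite -eqL; apply: subgroupV.
  case=> u [t [Ku Tt ey]].
  have {ey} ey : y = t^-1 * u^-1 by rewrite -invMg -ey invgK.
  have := subgroupV sT Tt => -[a [b et]].
  (* Euclidean division in the exponents, where the negative power [x ^- b] is
     written [x ^+ (b * n.-1)] times the inverse of [(x ^+ n) ^+ b]. *)
  have ht : t^-1 = x ^+ ((a + b * n.-1) %% n) *
      (x ^+ n ^+ ((a + b * n.-1) %/ n) / x ^+ n ^+ b).
    have eb : (n * b = b + b * n.-1)%N by rewrite -mulnS prednK // mulnC.
    rewrite mulgA -!expgnA -expgnDr eb addnC [(n * (_ %/ _))%N]mulnC -divn_eq et.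
    by rewrite -expg_div_mul mulgV mulg1.
  have [r Rr [v Lv ev]] := tu (x ^+ n ^+ ((a + b * n.-1) %/ n) / x ^+ n ^+ b) u^-1
    (ex_intro _ _ (ex_intro _ _ erefl)) (subgroupV sK Ku).
  exists (x ^+ ((a + b * n.-1) %% n) * r).
    by apply: allpairs_f => //; rewrite mem_iota /= ltn_mod.
  by exists v => //; rewrite ey ht -mulgA ev mulgA.
elim=> {H h} [|H K x h sH nK eH [n n0 Kxn] _ [sK [k hk]]|H K x h sH nK eH nKx _ [sK [k hk]]].
- split; first by split=> [//|_ _ -> ->]; rewrite /= mulgV.
  exists 1%N => m m0; exists [:: 1] => // _ ->.
  exists 1; first by rewrite inE.
  by exists 1; [apply: subgroup1; exact: power_subgroup_subgroup|rewrite mulg1].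
- split=> //; exists (n * k)%N => m m0; have [R sizeR coverR] := hk m m0.
  rewrite -mulnA; apply: (step H K x n m _ R) => // t u Tt Ku.
  have Kt : K t by apply: cyclic_of_sub Tt.
  have [r Rr [v Pv ->]] := coverR _ (subgroupM sK Kt Ku).
  exists r => //; exists v => //; apply: power_subgroupS Pv.
  by case: nK.
- split=> //; exists k => m m0; have [R sizeR coverR] := hk m m0.
  rewrite expnS mulnCA; apply: (step H K x m m _ R) => // t u Tt Ku.
  have [Hx _ _] := cyclic_ext_decomp sH nK eH.
  have Pt : power_subgroup H m t.
    apply: cyclic_of_sub Tt; first exact: power_subgroup_subgroup.
    exact: mem_power_subgroup.
  have Ht : H t by apply: power_subgroup_sub Pt.
  case: nK => _ KH KJ.
  have [r Rr [v Pv ev]] := coverR _ (KJ _ _ (subgroupV sH Ht) Ku).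
  exists r => //; exists (v * t).
    by apply: (subgroupM (power_subgroup_subgroup H m) _ Pt); apply: power_subgroupS Pv.
  by rewrite mulgA -ev conjgE invgK !mulgA mulgVK.
Qed.

(** Two of the powers [x ^+ 0, ..., x ^+ (size R)] fall into the same left coset of
    [L]; pigeonhole replaces Lagrange's theorem, as [L] may fail to be normal. *)
Lemma left_cover_power H L R : is_subgroup H -> is_subgroup L ->
  left_cover H L R -> forall x, H x -> L (x ^+ (size R)`!).
Proof.
move=> sH sL cov x Hx.
have /choice[r hr] : forall i : 'I_(size R).+1, exists r : 'I_(size R),
    exists2 l, L l & x ^+ i = tnth (in_tuple R) r * l.
  move=> i; have [y Ry hy] := cov _ (subgroupX i sH Hx).
  have hi : (index y R < size R)%N by rewrite index_mem.
  by exists (Ordinal hi); rewrite (tnth_nth 1) /= nth_index.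
have /injectivePn[i [j neq_ij eq_r]] : ~~ injectiveb r.
  apply/negP => /injectiveP/leq_card.
  by rewrite !card_ord ltnn.
wlog lt_ij : i j neq_ij eq_r / (i < j)%N.
  move=> IH; have [lt_ij|lt_ji|/val_inj eq_ij] := ltngtP i j; first exact: (IH i j).
    by apply: (IH j i) => //; rewrite eq_sym.
  by rewrite eq_ij eqxx in neq_ij.
have [l Ll el] := hr i; have [l' Ll' el'] := hr j.
have Lij : L (x ^+ (j - i)).
  have -> : x ^+ (j - i) = l^-1 * l'.
    apply: (mulgI (x ^+ i)); rewrite -expgnDr subnKC ?(ltnW lt_ij) // el' el eq_r.
    by rewrite mulgA mulgK.
  by apply: subgroupM => //; apply: subgroupV.
have /dvdnP[q ->] : (j - i %| (size R)`!)%N.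
  by rewrite dvdn_fact // subn_gt0 lt_ij (leq_trans (leq_subr _ _)) // -ltnS.
by rewrite mulnC expgnA; apply: subgroupX.
Qed.

End PowerSubgroups.

(** * Separation by polynomial functions *)

Section Separation.
Variable G : groupType.
Implicit Types (H K M T P : set G) (x y t : G) (R S : seq G) (f : G -> int).

(** When [M] and [T] meet trivially, the factor [u] of [u * t] is determined, and
    this is the extension of [f] to [M T] that ignores [t]. *)
Definition extend_left M T f : G -> int :=
  fun x => f (xget 1 [set u | M u /\ T (u^-1 * x)]).

(** When [x] normalizes [M] and no positive power of [x] lies in [M], this is the
    homomorphism from [M <x>] to the integers with kernel [M] that maps [x] to 1:
    the pair [(a, b)] is not determined, but [a - b] is. *)
Definition cyclic_degree M x : G -> int := fun y =>
  let ab := xget (0, 0)%N [set ab | exists2 u, M u &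
              y = u * (x ^+ ab.1 / x ^+ ab.2)] in (ab.1%:Z - ab.2%:Z)%R.

Lemma expg_div_mem_inf M x a b : is_subgroup M ->
  (forall n, (0 < n)%N -> ~ M (x ^+ n)) -> M (x ^+ a / x ^+ b) -> a = b.
Proof.
move=> sM Minf.
wlog le_ba : a b / (b <= a)%N.
  move=> IH Mab; have [le_ba|/ltnW le_ab] := leqP b a; first exact: IH.
  by apply/esym/IH => //; rewrite -invgF; apply: subgroupV.
rewrite -expgnFr // => Mab; apply/eqP; rewrite eqn_leq le_ba andbT.
rewrite leqNgt; apply/negP => lt_ba; apply: (Minf (a - b)%N) => //.
by rewrite subn_gt0.
Qed.

Section CyclicExtension.
Variables (M : set G) (x : G).
Hypotheses (sM : is_subgroup M) (MJ : forall u t, M u -> cyclic_of x t -> M (u ^ t)).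
Hypothesis (Minf : forall n, (0 < n)%N -> ~ M (x ^+ n)).
Let sT := cyclic_of_subgroup x.

Lemma cyclic_degreeE u a b : M u ->
  cyclic_degree M x (u * (x ^+ a / x ^+ b)) = (a%:Z - b%:Z)%R.
Proof.
move=> Mu; rewrite /cyclic_degree.
case: xgetP => [[a' b'] _ [v /= Mv e]|/(_ (a, b)) []]; last by exists u.
suff : (a + b' = a' + b)%N by lia.
apply: (expg_div_mem_inf sM Minf).
have -> : x ^+ (a + b') / x ^+ (a' + b) = u^-1 * v.
  apply: (mulgI u); rewrite mulVKg [(a' + b)%N]addnC -expg_div_mul mulgA e.
  rewrite -mulgA expg_div_mul [(b' + a')%N]addnC mulgV mulg1 //.
by apply: subgroupM => //; apply: subgroupV.
Qed.

Lemma cyclic_degreeM y z : set_mul M (cyclic_of x) y ->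
  set_mul M (cyclic_of x) z ->
  cyclic_degree M x (y * z) = (cyclic_degree M x y + cyclic_degree M x z)%R.
Proof.
move=> [u [_ [Mu [a [b ->]] ->]]] [v [_ [Mv [a' [b' ->]] ->]]].
set t := x ^+ a / x ^+ b.
have Mv' : M (v ^ t^-1) by apply: MJ => //; apply: subgroupV => //; exists a, b.
have -> : u * t * (v * (x ^+ a' / x ^+ b')) =
    (u * v ^ t^-1) * (x ^+ (a + a') / x ^+ (b + b')).
  by rewrite -expg_div_mul -/t conjgE invgK; move: t {Mv'} => t; rewrite !mulgA mulgVK.
rewrite !cyclic_degreeE //; [lia|exact: subgroupM].
Qed.

Lemma cyclic_degree_poly : poly_lt (set_mul M (cyclic_of x)) 2 (cyclic_degree M x).
Proof.
have sL := set_mul_subgroup sM sT MJ.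
move=> s Ls r Lr y Ly /=; rewrite /ldiff !cyclic_degreeM //; [lia|exact: subgroupM..].
Qed.

Lemma cyclic_trivI y : M y -> cyclic_of x y -> y = 1.
Proof.
by move=> My [a [b ey]]; rewrite ey in My *; rewrite (expg_div_mem_inf sM Minf My) mulgV.
Qed.

End CyclicExtension.

Lemma extend_leftE M T f u t : is_subgroup M -> is_subgroup T ->
  (forall x, M x -> T x -> x = 1) -> M u -> T t ->
  extend_left M T f (u * t) = f u.
Proof.
move=> sM sT MT1 Mu Tt; rewrite /extend_left; case: xgetP => [v _ [Mv Tv]|].
  congr f; have : v^-1 * u = 1.
    apply: MT1; first by apply: subgroupM => //; apply: subgroupV.
    by rewrite mulgA in Tv; apply: subgroupMr Tt Tv.
  by move=> e; rewrite -(mulVKg v u) e mulg1.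
by move=> /(_ u) []; split=> //; rewrite mulKg.
Qed.

Definition poly_separated P : Prop :=
  exists (d n : nat) (f : nat -> G -> int),
    [/\ forall i, (i < n)%N -> poly_lt P d (f i) /\ f i 1 = 0%R &
        forall g, P g -> g <> 1 -> exists2 i, (i < n)%N & f i g <> 0%R].

Lemma poly_separated_sub P P' : P' `<=` P -> poly_separated P -> poly_separated P'.
Proof.
move=> P'P [d [n [f [fP sep]]]]; exists d, n, f; split.
  by move=> i /fP[pf f1]; split=> //; apply: poly_lt_sub pf.
by move=> g /P'P Pg; apply: sep.
Qed.

Variable c : nat.
Hypothesis nilG : lower_central G c.+1 = [set 1].

(** The polynomials on [M] see the factor in [M], and the exponent of [x], which is
    a homomorphism to the integers, sees the other one. *)
Lemma poly_separated_ext M x : is_subgroup M ->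
  (forall u t, M u -> cyclic_of x t -> M (u ^ t)) ->
  (forall n, (0 < n)%N -> ~ M (x ^+ n)) ->
  poly_separated M -> poly_separated (set_mul M (cyclic_of x)).
Proof.
move=> sM MJ Minf [d [n [f [fP sep]]]].
have sT := cyclic_of_subgroup x.
have sL := set_mul_subgroup sM sT MJ.
have MT1 := cyclic_trivI sM Minf.
have extE h u t : M u -> cyclic_of x t ->
    extend_left M (cyclic_of x) h (u * t) = h u by exact: extend_leftE.
exists (maxn (d * c.+1) 2), n.+1, (fun i => if (i < n)%N then
  extend_left M (cyclic_of x) (f i) else cyclic_degree M x); split=> [i _|].
  case: ifP => [/fP[pf f1]|_]; split.
  - apply: (poly_lt_le sL (leq_maxl _ _)).
    apply: (wpoly_lt_extend sM sT MJ (f := f i)) => [u t Mu Tt|]; first exact: extE.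
    exact: (poly_lt_wpoly nilG sM pf).
  - by have := extE (f i) 1 1 (subgroup1 sM) (subgroup1 sT); rewrite mulg1 => ->.
  - apply: (poly_lt_le sL (leq_maxr _ _)); exact: cyclic_degree_poly.
  - have := cyclic_degreeE sM Minf 0 0 (subgroup1 sM).
    by rewrite mul1g divg1 subrr.
move=> _ [u [t [Mu Tt ->]]] ut1.
have [u1|u1] := pselect (u = 1).
  exists n => //; rewrite ltnn; case: Tt ut1 => a [b ->].
  rewrite cyclic_degreeE // u1 mul1g => ab1 e; apply: ab1.
  by have -> : a = b by [lia]; rewrite mulgV.
have [i lt_in fu] := sep u Mu u1.
by exists i; [exact: ltnW | rewrite lt_in extE].
Qed.

(** Passing to a power subgroup absorbs the finite factors of the series. At an
    infinite factor, the induction hypothesis speaks of a power subgroup [M] of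
    [K]; being characteristic in [K], it is normalized by [x], so the
    polynomials extend to [M <x>], which has finite index in [H] and therefore
    contains a power subgroup of [H]. *)
Lemma hirsch_poly_separated H h : hirsch_length_of H h ->
  exists2 E, (0 < E)%N & poly_separated (power_subgroup H E).
Proof.
elim=> {H h} [|H K x h sH nK eH [n n0 Kxn] _ [E E0 sep]
             |H K x h sH nK eH nKx hK [E E0 sep]].
- exists 1%N => //; exists 0%N, 0%N, (fun _ _ => 0%R); split=> // g Pg []; move: Pg.
  apply: (power_subgroup_min (K := [set 1])) => [|_ ->]; last by rewrite expg1n.
  by split=> [//|_ _ -> ->]; rewrite /= mulgV.
- exists (n * E)%N; first by rewrite muln_gt0 n0.
  apply: poly_separated_sub sep; apply: power_subgroup_mul => y Hy.
  have [Hx KJ eqH] := cyclic_ext_decomp sH nK eH.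
  have [sK KH _] := nK.
  rewrite eqH in Hy; case: Hy => u [t [Ku Tt ->]].
  suff [v Kv ->] : exists2 v, K v & (u * t) ^+ n = v * t ^+ n.
    apply: subgroupM => //; case: Tt => a [b ->].
    rewrite expgnFl; last by apply: commuteX2.
    rewrite -!expgnA ![(_ * n)%N]mulnC !expgnA.
    by apply: sK.2; apply: subgroupX.
  elim: n {n0 Kxn} => [|n [v Kv IHn]]; first by exists 1; [exact: subgroup1|rewrite mulg1].
  exists (v * u ^ (t ^- n)).
    apply: subgroupM => //; apply: KJ => //; apply: subgroupV; first exact: cyclic_of_subgroup.
    by apply: subgroupX => //; apply: cyclic_of_subgroup.
  by rewrite expgSr IHn [t ^+ n.+1]expgSr conjgE invgK !mulgA mulgVK.
- have [Hx KJ eqH] := cyclic_ext_decomp sH nK eH.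
  set M := power_subgroup K E in sep.
  have sM : is_subgroup M := power_subgroup_subgroup K E.
  have MJ u t : M u -> cyclic_of x t -> M (u ^ t) by exact: power_subgroupJ.
  have [sK _ _] := nK.
  have MK : M `<=` K := @power_subgroup_sub _ K E sK.
  have Minf n : (0 < n)%N -> ~ M (x ^+ n) by move=> n0 /MK; apply: nKx.
  have sepL := poly_separated_ext sM MJ Minf sep.
  have sL := set_mul_subgroup sM (cyclic_of_subgroup x) MJ.
  have [_ [k /(_ E E0)[R _ coverR]]] := hirsch_left_cover hK.
  exists (size R)`!; first exact: fact_gt0.
  apply: poly_separated_sub sepL.
  apply: power_subgroup_min => // y Hy.
  apply: (left_cover_power sH sL _ Hy) => z; rewrite eqH => -[u [t [Ku Tt ->]]].
  have [r Rr [v Mv ->]] := coverR u Ku.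
  by exists r => //; exists (v * t); [exists v, t | rewrite mulgA].
Qed.

End Separation.

(** * Values along words, and finite quotients *)

Section WordBounds.
Variable G : groupType.
Implicit Types (M P : set G) (x y g : G) (R S T w : seq G) (f : G -> int).

(** A polynomial grows at most polynomially along words, by induction on the degree:
    removing the first letter [s] of the word changes the value by [ldiff s f],
    which has lower degree. *)
Lemma word_poly_bound P S d f : is_subgroup P -> {in S, forall s, P s} ->
  poly_lt P d f -> exists C : nat, forall w : seq G, {subset w <= S} ->
    (`|f (\prod_(s <- w) s)%g| <= C * (size w).+1 ^ d)%N.
Proof.
move=> sP SP; elim: d f => [|d IHd] f pf.
  exists 0%N => w wS; rewrite pf //.
  elim: w wS => [|s w IHw] wS; first by rewrite big_nil; apply: subgroup1.
  rewrite big_cons; apply: subgroupM => //; first by apply/SP/wS; rewrite mem_head.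
  by apply: IHw => y yw; apply: wS; rewrite inE yw orbT.
have /choice[C hC] : forall s, exists C : nat, s \in S -> forall w : seq G, {subset w <= S} ->
    (`|ldiff s f (\prod_(s <- w) s)%g| <= C * (size w).+1 ^ d)%N.
  move=> s; have [Ss|nSs] := boolP (s \in S); last by exists 0%N.
  by have [C hC] := IHd _ (pf s (SP s Ss)); exists C.
pose D := (\sum_(s <- S) C s)%N.
exists (`|f 1%g| + D)%N.
have bnd w : {subset w <= S} ->
    (`|f (\prod_(s <- w) s)%g| <= `|f 1%g| + D * size w * (size w).+1 ^ d)%N.
  elim: w => [|s w IHw] wS; first by rewrite big_nil leq_addr.
  have Ss : s \in S by apply: wS; rewrite mem_head.
  have {}wS : {subset w <= S} by move=> y yw; apply: wS; rewrite inE yw orbT.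
  have := hC s Ss w wS; have := IHw wS; rewrite /ldiff big_cons /=.
  have : (C s <= D)%N by rewrite /D (big_rem s) //= leq_addr.
  have : ((size w).+1 ^ d <= (size w).+2 ^ d)%N by case: (d) => // e; rewrite leq_exp2r.
  set X := ((size w).+1 ^ d)%N; set Y := ((size w).+2 ^ d)%N.
  set a := f _; set b := f _ => XY CD h1 h2.
  have : (C s * X <= D * Y)%N by rewrite leq_mul.
  have : (D * size w * X <= D * size w * Y)%N by rewrite leq_mul2l XY orbT.
  have -> : (D * (size w).+1 * Y = D * size w * Y + D * Y)%N by rewrite mulnS mulnDl addnC.
  lia.
move=> w wS; apply: leq_trans (bnd w wS) _.
rewrite mulnDl leq_add //; first by rewrite leq_pmulr // expn_gt0.
by rewrite expnS mulnA leq_mul2r leq_mul2l leqnSn !orbT.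
Qed.

(** Schreier's rewriting: an element of the finite-index subgroup [P] that is short
    in [S] is short in a finite subset of [P]. *)
Lemma schreier_word P R S : is_subgroup P -> left_cover setT P R ->
  exists2 T : seq G, {in T, forall s, P s} & forall w : seq G, {subset w <= S} ->
    P (\prod_(s <- w) s) -> exists v : seq G, [/\ {subset v <= T},
      (size v <= (size w).+2)%N & \prod_(s <- v) s = \prod_(s <- w) s].
Proof.
move=> sP cov.
pose T := [seq x <- R ++ [seq r^-1 | r <- R] ++
  [seq r'^-1 * s | r' <- R, s <- [seq s * r | s <- S, r <- R]] | `[< P x >]].
have memT x : P x -> x \in R ++ [seq r^-1 | r <- R] ++
   [seq r'^-1 * s | r' <- R, s <- [seq s * r | s <- S, r <- R]] -> x \in T.
  by move=> Px xin; rewrite mem_filter xin andbT; apply/asboolP.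
exists T => [x|w wS Pw]; first by rewrite mem_filter => /andP[/asboolP].
have [r Rr [v [vT sizev ev]]] : exists2 r, r \in R & exists v,
    [/\ {subset v <= T}, (size v <= (size w).+1)%N &
      \prod_(s <- w) s = r * \prod_(s <- v) s].
  elim: w wS {Pw} => [|s w IHw] wS.
    (* The identity need not be in [R]: its coset representative [r] lies in [P],
       and both [r] and [r^-1] are letters. *)
    have [r Rr [k Pk e1]] := cov 1 I.
    exists r => //; exists [:: r^-1].
    have ek : k = r^-1 by rewrite -(mulKg r k) -e1 mulg1.
    rewrite big_nil big_seq1 mulgV; split=> // y; rewrite inE => /eqP->.
    by apply: memT; rewrite -?ek // ek !mem_cat map_f ?orbT.
  have Ss : s \in S by apply: wS; rewrite mem_head.
  have [|r Rr [v [vT sizev ev]]] := IHw.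
    by move=> y yw; apply: wS; rewrite inE yw orbT.
  have [r' Rr' [k Pk esr]] := cov (s * r) I.
  exists r' => //; exists (k :: v); split; last first.
  - by rewrite !big_cons ev !mulgA esr.
  - by rewrite /= ltnS.
  move=> y; rewrite inE => /orP[/eqP ->|]; last exact: vT.
  apply: memT => //; rewrite !mem_cat; apply/orP; right; apply/orP; right.
  by rewrite -(mulKg r' k) -esr; do 2!apply: allpairs_f => //.
have Pv : P (\prod_(s <- v) s).
  elim: v vT {sizev ev} => [|s v IHv] vT; first by rewrite big_nil; apply: subgroup1.
  rewrite big_cons; apply: subgroupM => //.
    by have := vT s (mem_head _ _); rewrite mem_filter => /andP[/asboolP].
  by apply: IHv => y yv; apply: vT; rewrite inE yv orbT.
exists (r :: v); split; last by rewrite big_cons ev.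
  move=> y; rewrite inE => /orP[/eqP ->|]; last exact: vT.
  apply: memT; last by rewrite mem_cat Rr.
  by apply: subgroupMr Pv _; rewrite // -ev.
by rewrite /= ltnS.
Qed.

Lemma nat_min_le (A : set nat) q : A q -> A (nat_min A) /\ (nat_min A <= q)%N.
Proof.
move=> Aq.
have exA : exists n, `[< A n >] by exists q; apply/asboolP.
rewrite /nat_min; case: xgetP => [m _ [Am lbm]|]; first by split=> //; apply: lbm.
case: (ex_minnP exA) => m /asboolP Am minm /(_ m) []; split=> // n An.
exact/minm/asboolP.
Qed.

(** The quotient by [M], carried by the set of first representatives in [R] of the
    cosets. *)
Lemma divisibility_finite_index M R g : is_subgroup M ->
  (forall x t, M x -> M (x ^ t)) -> left_cover setT M R -> ~ M g ->
  exists (Q : finGroupType) (phi : {multiplicative G -> Q}),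
    (#|Q| <= size R)%N /\ phi g <> 1.
Proof.
move=> sM MJ cov nMg.
pose cls x := nth 1 R (find (fun r => `[< M (r^-1 * x) >]) R).
have has_cls x : has (fun r => `[< M (r^-1 * x) >]) R.
  have [r Rr [k Mk ->]] := cov x I; apply/hasP; exists r => //.
  by apply/asboolP; rewrite mulKg.
have clsP x : M ((cls x)^-1 * x) by exact/asboolP/(nth_find 1 (has_cls x)).
have clsR x : cls x \in R by rewrite mem_nth // -has_find.
have clsE x y : M (x^-1 * y) -> cls x = cls y.
  move=> Mxy; congr nth; apply: eq_find => r; apply: asbool_equiv_eq; split=> Mr.
    by rewrite -(mulVKg x y) mulgA; apply: subgroupM.
  have -> : r^-1 * x = (r^-1 * y) * (x^-1 * y)^-1 by rewrite invMg invgK !mulgA mulgK.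
  by apply: subgroupM => //; apply: subgroupV.
have cls_id x : cls (cls x) = cls x by apply: clsE.
pose reps := undup (map cls R).
have cls_reps x : cls x \in reps by rewrite mem_undup -cls_id map_f.
pose Q0 := seq_sub reps.
pose inQ x : Q0 := SeqSub (cls_reps x).
have inQE x y : M (x^-1 * y) -> inQ x = inQ y.
  by move=> Mxy; apply: val_inj => /=; apply: clsE.
have valQ x : M ((val (inQ x))^-1 * x) by exact: clsP.
have inQ_val (q : Q0) : inQ (val q) = q.
  by apply: val_inj => /=; have := valP q; rewrite mem_undup => /mapP[r _ ->]; rewrite cls_id.
have inQM x y : inQ (val (inQ x) * val (inQ y)) = inQ (x * y).
  apply: inQE; rewrite invMg.
  have -> : (val (inQ y))^-1 * (val (inQ x))^-1 * (x * y) =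
    ((val (inQ y))^-1 * y) * (((val (inQ x))^-1 * x) ^ y).
    by rewrite conjgE !mulgA mulgK.
  by apply: subgroupM => //; apply: MJ.
have mulA : associative (fun p q : Q0 => inQ (val p * val q)).
  move=> p q r; rewrite -[X in inQ (X * _) = _](congr1 val (inQ_val p)).
  rewrite -[X in _ = inQ (_ * X)](congr1 val (inQ_val r)).
  by rewrite !inQM mulgA.
have mul1 : left_id (inQ 1) (fun p q : Q0 => inQ (val p * val q)).
  by move=> p; rewrite -[X in inQ (_ * X)](congr1 val (inQ_val p)) inQM mul1g inQ_val.
have mulV : left_inverse (inQ 1) (fun p : Q0 => inQ (val p)^-1)
    (fun p q : Q0 => inQ (val p * val q)).
  by move=> p; rewrite -[X in inQ (_ * X)](congr1 val (inQ_val p)) inQM mulVg.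
pose Q : finGroupType := HB.pack Q0 (Finite_isGroup.Build Q0 mulA mul1 mulV).
pose phi0 : G -> Q := inQ.
have phiM : {morph phi0 : x y / x * y >-> x * y} by move=> x y; rewrite -[LHS]inQM.
pose phi : {multiplicative G -> Q} := HB.pack phi0 (isMultiplicative.Build G Q phi0 phiM).
exists Q, phi; split.
  apply: leq_trans (_ : size reps <= _)%N; last by rewrite -(size_map cls) size_undup.
  by rewrite -(card_seq_sub (undup_uniq (map cls R))).
move=> e; apply: nMg.
have {}e : cls g = cls 1 := congr1 val e.
have M1 : M (cls 1) by have := subgroupV sM (clsP 1); rewrite mulg1 invgK.
by rewrite -(mulVKg (cls g) g); apply: subgroupM => //; rewrite e.
Qed.

End WordBounds.

(** * Small finite quotients *)

Section Upper.
Variables (G : groupType) (c h : nat).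
Hypotheses (nilG : lower_central G c.+1 = [set 1]) (hirG : has_hirsch_length G h).
Variable S : seq G.

(** The elements [p] for which [f] is invariant modulo [m] form a subgroup, which
    contains the [d`! * m]-th powers. *)
Lemma power_subgroup_poly_mod (P : set G) d (f : G -> int) m p x :
  is_subgroup P -> poly_lt P d f -> power_subgroup P (d`! * m) p -> P x ->
  (m%:Z %| (f (p * x)%g - f x)%R)%Z.
Proof.
move=> sP pf Pp; suff [] : P p /\ forall x, P x ->
  (m%:Z %| (f (p * x)%g - f x)%R)%Z by move=> _; apply.
move: p Pp {x}; apply: (power_subgroup_min (K := [set p | P p /\
  forall x, P x -> (m%:Z %| (f (p * x)%g - f x)%R)%Z])) => [|s Ps]; last first.
  by split=> [|x Px]; [exact: subgroupX | apply: poly_lt_power_mod Px pf].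
apply: is_subgroup_intro => [|p q [Pp hp] [Pq hq]|p [Pp hp]].
- by split=> [|x Px]; [exact: subgroup1 | rewrite mul1g subrr dvdz0].
- split=> [|x Px]; first exact: subgroupM.
  rewrite -mulgA -[f _](subrK (f (q * x))) -addrA.
  by apply: rpredD; [apply: hp; apply: subgroupM | apply: hq].
- split=> [|x Px]; first exact: subgroupV.
  have := hp (p^-1 * x) (subgroupM sP (subgroupV sP Pp) Px).
  by rewrite mulVKg -opprB rpredN.
Qed.

(** A nonzero value [a] of a polynomial at [g] has [ln |a|] at most of order
    [ln (size w)]. If all positive [j <= 2 y] divided it, then [|a|] would be at
    least [2 ^ (2 y)] up to a linear factor; and when [j] does not divide it, [g]
    is not in a power subgroup whose exponent is a constant times [j]. *)
Lemma separating_exponent : exists A : nat, forall (w : seq G) y,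
  {subset w <= S} -> \prod_(s <- w) s <> 1 -> (A * (size w).+1 ^ A < 2 ^ y)%N ->
  exists2 m, (0 < m <= A * y.+1)%N & ~ power_subgroup setT m (\prod_(s <- w) s).
Proof.
have [E E0 [d [n [f [fP sep]]]]] := hirsch_poly_separated nilG hirG.
set P := power_subgroup setT E in fP sep.
have sP : is_subgroup P := power_subgroup_subgroup setT E.
have [_ [k /(_ E E0)[R _ coverR]]] := hirsch_left_cover hirG.
have [T TP rewT] := schreier_word S sP coverR.
have /choice[C hC] : forall i, exists C : nat, (i < n)%N -> forall v : seq G, {subset v <= T} ->
    (`|f i (\prod_(s <- v) s)%g| <= C * (size v).+1 ^ d)%N.
  move=> i; have [lt_in|le_ni] := ltnP i n; last by exists 0%N.
  by have [C hC] := word_poly_bound sP TP (fP i lt_in).1; exists C.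
pose D := (\sum_(i < n) C i)%N.
(* One constant serves as factor, as exponent of the word length and as factor
   of [y]; the summands are what each of these uses needs. *)
exists (E + 2 * E * d`! + 2 * D * 3 ^ d + d.+1)%N => w y wS w1 lt_y.
set g := \prod_(s <- w) s in w1 *.
have [Pg|nPg] := pselect (P g); last first.
  by exists E => //; rewrite E0 -!addnA mulnDl (leq_trans _ (leq_addr _ _)) // leq_pmulr.
have [i lt_in fg] := sep g Pg w1.
have bnd : (`|f i g| <= D * 3 ^ d * (size w).+1 ^ d)%N.
  have [v [vT sizev ev]] := rewT w wS Pg.
  rewrite /g -ev; apply: leq_trans (hC i lt_in v vT) _.
  rewrite -mulnA -expnMn leq_mul //.
    by rewrite /D (bigD1 (Ordinal lt_in)) //= leq_addr.
  by case: (d) => // d1; rewrite leq_exp2r //; lia.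
have [j j_range ndvd] : exists2 j, (0 < j <= 2 * y)%N & ~~ (j %| `|f i g|)%N.
  apply/not_exists2P => all_dvd.
  have dvdL : (lcm_upto (2 * y) %| `|f i g|)%N.
    by apply: lcm_upto_dvd => j hj; have [//|/negP/negPn] := all_dvd j.
  have leL : (lcm_upto (2 * y) <= `|f i g|)%N by rewrite dvdn_leq // absz_gt0; apply/eqP.
  have := exp2_le_lcm_upto (2 * y); rewrite leqNgt => /negP; apply.
  have lt1 : ((2 * y).+1 < 2 * 2 ^ y)%N by have := ltn_expl y (ltnSn 1); lia.
  have lt2 : (2 * `|f i g| < 2 ^ y)%N.
    apply: leq_ltn_trans lt_y; rewrite mulnDl.
    apply: leq_trans (leq_addr _ _); rewrite mulnDl; apply: leq_trans (leq_addl _ _).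
    apply: leq_trans (_ : 2 * (D * 3 ^ d * (size w).+1 ^ d) <= _)%N; first by rewrite leq_mul2l.
    rewrite !mulnA leq_mul2l leq_pexp2l ?orbT //; lia.
  rewrite [in X in (_ < X)%N]mul2n -addnn expnD; apply: leq_ltn_trans
      (_ : (2 * y).+1 * `|f i g| < _)%N.
    by rewrite leq_mul2l leL orbT.
  have : (0 < 2 ^ y)%N by rewrite expn_gt0.
  nia.
exists (E * (d`! * j))%N.
  have := fact_gt0 d => d0; case/andP: j_range => j0 le_j.
  rewrite !muln_gt0 E0 d0 j0 /= mulnA.
  apply: leq_trans (_ : E * d`! * (2 * y) <= _)%N; first by rewrite leq_mul2l le_j orbT.
  have -> : (E * d`! * (2 * y) = 2 * E * d`! * y)%N by lia.
  by rewrite leq_mul // -!addnA; lia.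
move=> Ng; move/negP: ndvd; apply.
have Pg' : power_subgroup P (d`! * j) g.
  by apply: power_subgroup_mul Ng => x _; apply: mem_power_subgroup.
have [pf f1] := fP i lt_in.
have := power_subgroup_poly_mod sP pf Pg' (subgroup1 sP).
by rewrite mulg1 f1 subr0 dvdzE.
Qed.

Lemma divisibility_upper : exists A : nat, forall (w : seq G) y,
  {subset w <= S} -> \prod_(s <- w) s <> 1 -> (A * (size w).+1 ^ A < 2 ^ y)%N ->
  exists (Q : finGroupType) (phi : {multiplicative G -> Q}),
    (#|Q| <= A * y.+1 ^ h)%N /\ phi (\prod_(s <- w) s) <> 1.
Proof.
have [A hA] := separating_exponent.
have [_ [k hk]] := hirsch_left_cover hirG.
exists (A + k * A ^ h)%N => w y wS w1 lt_y.
have [|m /andP[m0 le_m] Nm] := hA w y wS w1.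
  apply: leq_ltn_trans lt_y; rewrite leq_mul ?leq_addr //.
  by rewrite leq_pexp2l ?leq_addr.
have [R sizeR coverR] := hk m m0.
have MJ (x t : G) : power_subgroup setT m x -> power_subgroup setT m (x ^ t).
  by move=> Mx; apply: (@power_subgroupJ _ setT setT m _ _ t Mx).
have [Q [phi [leQ nphi]]] := divisibility_finite_index
  (power_subgroup_subgroup _ _) MJ coverR Nm.
exists Q, phi; split=> //; apply: leq_trans leQ (leq_trans sizeR _).
rewrite mulnDl; apply: leq_trans (leq_addl _ _).
rewrite -mulnA -expnMn leq_mul2l; case: (h) => [|h']; first by rewrite orbT.
by rewrite leq_exp2r ?le_m ?orbT.
Qed.

End Upper.

(** * Iterated commutators and large finite quotients *)

Section IteratedCommutators.

Definition iter_comm (G : groupType) (g : G) (ys : seq G) : G :=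
  foldl (fun x y => [~ x, y]) g ys.

Section MultiplicativeGroup.
Variables (G Q : groupType) (phi : {multiplicative G -> Q}).

Lemma mult1 : phi 1 = 1.
Proof. by apply: (mulgI (phi 1)); rewrite -gmulfM !mulg1. Qed.

Lemma multV x : phi x^-1 = (phi x)^-1.
Proof. by apply: (mulgI (phi x)); rewrite -gmulfM !mulgV mult1. Qed.

Lemma multX x n : phi (x ^+ n) = phi x ^+ n.
Proof. by elim: n => [|n IHn]; [exact: mult1 | rewrite !expgS gmulfM IHn]. Qed.

Lemma multR x y : phi [~ x, y] = [~ phi x, phi y].
Proof. by rewrite !commgEl !conjgE !gmulfM !multV. Qed.

Lemma iter_comm_morph g ys : phi (iter_comm g ys) = iter_comm (phi g) (map phi ys).
Proof. by elim: ys g => //= y ys IH g; rewrite IH multR. Qed.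

End MultiplicativeGroup.

Lemma iter_comm1 (G : groupType) (ys : seq G) : iter_comm 1 ys = 1.
Proof. by elim: ys => //= y ys; rewrite comm1g. Qed.

Variables (G : groupType) (c : nat).
Hypothesis nilG : lower_central G c.+1 = [set 1].
Local Notation gamma := (lower_central G).
Implicit Types (g u w : G) (ys : seq G).

Lemma commMg_mul g g' y : [~ g * g', y] = [~ g, y] * [~ [~ g, y], g'] * [~ g', y].
Proof.
rewrite [X in _ * X * _]commgEl mulVKg !commgEl !conjgE !invMg.
by rewrite !mulgA !mulgK.
Qed.

Lemma commgM_mul y g g' : [~ y, g * g'] = [~ y, g'] * [~ y, g] * [~ [~ y, g], g'].
Proof.
rewrite -mulgA [X in _ * (_ * X)]commgEl mulVKg !commgEl !conjgE !invMg.
by rewrite !mulgA !mulgK.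
Qed.

Lemma iter_comm_mem i g ys : gamma i g -> gamma (i + size ys) (iter_comm g ys).
Proof.
elim: ys i g => [|y ys IH] i g gi /=; first by rewrite addn0.
by rewrite -addSnnS; apply: IH; apply: lower_central_comm.
Qed.

Lemma iter_comm_kill i g ys : (i + size ys = c)%N -> gamma i.+1 g -> iter_comm g ys = 1.
Proof.
move=> eqc gi; apply: (lower_central_trivial nilG (ltnSn c)).
by rewrite -eqc -addSn; apply: iter_comm_mem.
Qed.

(** [[~ g * g', y]] differs from [[~ g, y] * [~ g', y]] by a commutator one step
    deeper, which dies in the remaining commutators. *)
Lemma iter_commM i g g' ys : (i + size ys = c)%N -> gamma i g -> gamma i g' ->
  iter_comm (g * g') ys = iter_comm g ys * iter_comm g' ys.
Proof.
elim: ys i g g' => //= y ys IH i g g'; rewrite -addSnnS => eqc gi gi'.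
have gc := lower_central_comm y gi; have gc' := lower_central_comm y gi'.
have gcc := lower_central_comm g' gc.
rewrite commMg_mul (IH i.+1) ?(IH i.+1 [~ g, y]) // ?(iter_comm_kill eqc gcc) ?mulg1 //.
- exact: lower_centralS.
- by apply: (subgroupM (lower_central_subgroup _ _) gc); apply: lower_centralS.
Qed.

Lemma iter_commX i g n ys : (i + size ys = c)%N -> gamma i g ->
  iter_comm (g ^+ n) ys = iter_comm g ys ^+ n.
Proof.
move=> eqc gi; elim: n => [|n IHn]; first exact: iter_comm1.
rewrite !expgS (iter_commM eqc gi) ?IHn //.
by apply: subgroupX gi; apply: lower_central_subgroup.
Qed.

(** Again the correction term is a commutator one step deeper. *)
Lemma iter_comm2M y g g' ys : (2 + size ys = c)%N ->
  iter_comm [~ y, g * g'] ys = iter_comm [~ y, g'] ys * iter_comm [~ y, g] ys.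
Proof.
move=> eqc.
have g1 x : gamma 1 x by [].
have gc x := lower_central_comm x (g1 y).
have gcc := lower_central_comm g' (gc g).
have gcc' := lower_centralS gcc.
have g2 : gamma 2 ([~ y, g'] * [~ y, g]).
  by apply: (subgroupM (lower_central_subgroup _ _)); apply: gc.
rewrite commgM_mul (iter_commM eqc g2 gcc') (iter_commM eqc (gc _) (gc _)).
by rewrite (iter_comm_kill eqc gcc) mulg1.
Qed.

Lemma iter_comm2X y g n ys : (2 + size ys = c)%N ->
  iter_comm [~ y, g ^+ n] ys = iter_comm [~ y, g] ys ^+ n.
Proof.
move=> eqc; elim: n => [|n IHn]; first by rewrite commg1 iter_comm1.
by rewrite expgS expgSr iter_comm2M // IHn.
Qed.

(** The last term is generated by commutators of elements of the preceding one, and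
    an iterated commutator is multiplicative in its first entry, so a nontrivial
    value is taken on generators; one descends until the first entry is an
    arbitrary element. *)
Lemma nontrivial_simple_comm : (0 < c)%N -> gamma c <> [set 1] ->
  exists y ys, (size ys).+1 = c /\ iter_comm y ys <> 1.
Proof.
move=> c0 gc.
suff main i g ys : (0 < i)%N -> (i + size ys = c)%N -> gamma i g ->
    iter_comm g ys <> 1 -> exists y ys, (size ys).+1 = c /\ iter_comm y ys <> 1.
  have [g [gg g1]] : exists g, gamma c g /\ g <> 1.
    apply: contrapT => /forallNP none; apply: gc; rewrite predeqE => x; split=> [gx|->].
      by apply: contrapT => x1; apply: (none x).
    exact: (subgroup1 (lower_central_subgroup _ _)).
  by apply: (main c g [::]) => //=; rewrite addn0.
elim: i g ys => // -[_ g ys _ eqc _ g1|i IH g ys _ eqc gi g1]; first by exists g, ys.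
have [[x [y [gx xy1]]]|none] := pselect (exists x y, gamma i.+1 x /\ iter_comm [~ x, y] ys <> 1).
  by apply: (IH x (y :: ys)) => //=; rewrite -addSnnS.
exfalso; apply: g1.
suff [] : gamma i.+2 g /\ iter_comm g ys = 1 by [].
apply: (@subgroup_gen_sub _ _ [set g | gamma i.+2 g /\ iter_comm g ys = 1] _ _ g gi) => /=.
  have sg := lower_central_subgroup G i.+2.
  apply: is_subgroup_intro => /= [|x y [gx ex] [gy ey]|x [gx ex]].
  - by rewrite iter_comm1; split=> //; apply: (subgroup1 sg).
  - by rewrite (iter_commM eqc) // ex ey mulg1; split=> //; apply: (subgroupM sg).
  - have gV := subgroupV sg gx; split=> //.
    have := iter_commM eqc gx gV; by rewrite mulgV iter_comm1 ex mul1g.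
move=> _ [x [y [gx _ ->]]]; split; first exact: (@lower_central_comm G i.+1 x y gx).
by apply: contrapT => xy1; apply: none; exists x, y.
Qed.

(** The hypothesis on [psi] makes the products [w ^+ a * u], for [a < #[z]] and [u]
    in [B], pairwise distinct: [psi] recovers [a]. *)
Lemma card_cyclic_step (Q : finGroupType) (A B : {set Q}) (w z : Q) (psi : Q -> Q) :
  (forall a (u : Q), u \in B -> w ^+ a * u \in A) ->
  (forall a (u : Q), u \in B -> psi (w ^+ a * u) = z ^+ a) -> (#[z] * #|B| <= #|A|)%N.
Proof.
move=> AB psiE.
pose f (p : 'I_#[z] * Q) := w ^+ p.1 * p.2.
have -> : (#[z] * #|B|)%N = #|[set f p | p in finset.setX [set: 'I_#[z]] B]%SET|.
  rewrite card_in_imset ?cardsX ?cardsT ?card_ord // => -[a u] [a' u'].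
  rewrite !inE /= /f /= => uB u'B e.
  have : z ^+ a == z ^+ a' by rewrite -(psiE a _ uB) -(psiE a' _ u'B) e.
  rewrite eq_expg_mod_order !modn_small // => /eqP/val_inj ea; rewrite ea in e *.
  by rewrite (mulgI _ _ _ e).
apply: subset_leq_card; apply/fintype.subsetP => _ /imsetP[[a u] uB ->].
by apply: AB; move: uB; rewrite !inE.
Qed.

Section Quotient.
Variables (Q : finGroupType) (phi : {multiplicative G -> Q}).

Definition gamma_image i : {set Q} :=
  [set q : Q | `[< exists2 g, gamma i g & phi g = q >]]%SET.

Lemma mem_gamma_image i g : gamma i g -> phi g \in gamma_image i.
Proof. by move=> gi; rewrite inE; apply/asboolP; exists g. Qed.

Lemma gamma_imageP i q : q \in gamma_image i -> exists2 g, gamma i g & phi g = q.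
Proof. by rewrite inE => /asboolP. Qed.

Let step i w ys : (i + size ys = c)%N -> gamma i w ->
  (#[phi (iter_comm w ys)] * #|gamma_image i.+1| <= #|gamma_image i|)%N.
Proof.
move=> eqc gi; have sg := lower_central_subgroup G i.
apply: (card_cyclic_step (w := phi w) (psi := fun x => iter_comm x (map phi ys))) =>
    a _ /gamma_imageP[u ui <-]; rewrite -multX -gmulfM.
  apply: mem_gamma_image; apply: (subgroupM sg); first exact: subgroupX.
  exact: lower_centralS.
rewrite -iter_comm_morph (iter_commM eqc) ?(iter_comm_kill eqc ui) ?mulg1.
- by rewrite (iter_commX _ eqc) // multX.
- exact: subgroupX.
- exact: lower_centralS.
Qed.

(** Each of the [(size ys).+1] successive quotients of the images of the lower central
    series has at least the order of the iterated commutator, since commuting with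
    the remaining entries detects the powers of the partial commutator. *)
Lemma card_gamma_image i w ys : (i + size ys = c)%N -> gamma i w ->
  (#[phi (iter_comm w ys)] ^ (size ys).+1 <= #|gamma_image i|)%N.
Proof.
elim: ys i w => [|y ys IH] i w eqc gi.
  have B0 : (0 < #|gamma_image i.+1|)%N.
    apply/card_gt0P; exists (phi 1); apply: mem_gamma_image.
    exact: (subgroup1 (lower_central_subgroup _ _)).
  by rewrite expn1 (leq_trans _ (step eqc gi)) // leq_pmulr.
rewrite expnS; apply: leq_trans (step eqc gi).
rewrite leq_mul2l (IH i.+1) ?orbT //; first by rewrite -eqc addSnnS.
exact: lower_central_comm.
Qed.

(** The [c - 1] lower steps of the central series contribute one factor each. The
    abelianization contributes two: the powers of [y1] are detected by commuting
    with [y2], and those of [y2] by commuting with [y1]. *)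
Lemma card_image_lower y1 y2 ys : (2 + size ys = c)%N ->
  (#[phi (iter_comm y1 (y2 :: ys))] ^ c.+1 <= #|Q|)%N.
Proof.
move=> eqc; set q := #[_].
have h1 : (q ^ c.-1 <= #|gamma_image 2|)%N.
  have -> : c.-1 = (size ys).+1 by rewrite -eqc.
  by apply: card_gamma_image => //; apply: lower_central_comm.
pose B : {set Q} := [set x | `[< exists a (u : Q), u \in gamma_image 2 /\ x = phi y2 ^+ a * u >]]%SET.
have h2 : (q * #|gamma_image 2| <= #|B|)%N.
  apply: (card_cyclic_step (w := phi y2)
    (psi := fun x => iter_comm [~ phi y1, x] (map phi ys))) => [a u u2|a _ /gamma_imageP[u u2 <-]].
    by rewrite inE; apply/asboolP; exists a, u.
  rewrite -multX -gmulfM -multR -iter_comm_morph iter_comm2M //.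
  rewrite (iter_comm_kill eqc (lower_central_commV y1 u2)) mul1g.
  by rewrite iter_comm2X // multX.
have eqc1 : (1 + size (y2 :: ys) = c)%N by rewrite -eqc.
have h3 : (q * #|B| <= #|Q|)%N.
  rewrite -cardsT; apply: (card_cyclic_step (w := phi y1)
    (psi := fun x => iter_comm x (map phi (y2 :: ys)))) => [a u _|a x].
    by rewrite inE.
  rewrite inE => /asboolP[b [_ [/gamma_imageP[u u2 <-] ->]]].
  rewrite -!multX -!gmulfM -iter_comm_morph !(iter_commM eqc1) // (iter_comm_kill eqc1 u2).
  have -> : iter_comm (y2 ^+ b) (y2 :: ys) = 1.
    by rewrite (iter_commX _ eqc1) // /= commgg iter_comm1 expg1n.
  by rewrite !mulg1 (iter_commX _ eqc1) // multX.
have -> : c.+1 = c.-1.+2 by rewrite -eqc.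
rewrite !expnS; apply: leq_trans h3; rewrite leq_mul2l; apply/orP; right.
by apply: leq_trans h2; rewrite leq_mul2l h1 orbT.
Qed.

End Quotient.
End IteratedCommutators.

(** * The Heisenberg group *)

Section Heisenberg.
Implicit Types (a b c : int).

Definition heis a b c : heisenberg := Sub (heis_mx a b c) (heis_mx_unitriangular a b c).

Lemma heis_surj x : exists a b c, x = heis a b c.
Proof. by do 3!eexists; apply: val_inj; rewrite /= [LHS](unitriangular3E (valP x)). Qed.

Lemma heis_inj a b c a' b' c' : heis a b c = heis a' b' c' -> [/\ a = a', b = b' & c = c'].
Proof.
move=> /(congr1 val) /= /matrixP e.
have := e (@Ordinal 3 0 isT) (@Ordinal 3 1 isT).
have := e (@Ordinal 3 1 isT) (@Ordinal 3 2 isT).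
by have := e (@Ordinal 3 0 isT) (@Ordinal 3 2 isT); rewrite !mxE /=.
Qed.

Lemma heisM a b c a' b' c' :
  heis a b c * heis a' b' c' = heis (a + a') (b + b') (c + c' + a * b').
Proof. by apply: val_inj => /=; rewrite heis_mxM. Qed.

Lemma heis1 : 1 = heis 0 0 0.
Proof. by apply: val_inj => /=; rewrite heis_mx0. Qed.

Lemma heisV a b c : (heis a b c)^-1 = heis (- a) (- b) (a * b - c).
Proof.
apply: mulg1_eq; rewrite heisM heis1; congr heis; ring.
Qed.

Lemma heis_comm a b c a' b' c' :
  [~ heis a b c, heis a' b' c'] = heis 0 0 (a * b' - a' * b).
Proof. by rewrite commgEl conjgE !heisV !heisM; congr heis; ring. Qed.

Lemma heisX a b c n : exists c', heis a b c ^+ n = heis (a *+ n) (b *+ n) c'.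
Proof.
elim: n => [|n [c' IHn]]; first by exists 0%R; rewrite expg0 heis1.
by eexists; rewrite expgS IHn heisM -!mulrS.
Qed.

Lemma heisX0 a b c n : (a * b = 0)%R -> heis a b c ^+ n = heis (a *+ n) (b *+ n) (c *+ n).
Proof.
move=> ab0; elim: n => [|n IHn]; first by rewrite expg0 heis1.
by rewrite expgS IHn heisM -!mulrS mulrnAr ab0 mul0rn addr0.
Qed.

Lemma heis_torsion_free : torsion_free heisenberg.
Proof.
move=> x n n0; have [a [b [c ->]]] := heis_surj x.
have cancel0 (d : int) : (d *+ n = 0)%R -> d = 0%R.
  by move=> /eqP; rewrite mulrn_eq0 -[n == 0%N]negbK -lt0n n0 => /eqP.
move=> e; have [c' e'] := heisX a b c n.
have [/cancel0 a0 /cancel0 b0 _] : [/\ a *+ n = 0, b *+ n = 0 & c' = 0]%R.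
  by apply: heis_inj; rewrite -e' e heis1.
move: e; rewrite heisX0 ?a0 ?mul0r // heis1 => /heis_inj[_ _ /cancel0 ->].
by rewrite b0.
Qed.

Definition heis_a0 : set heisenberg := [set x | exists b c, x = heis 0 b c].
Definition heis_center : set heisenberg := [set x | exists c, x = heis 0 0 c].

Lemma heis_a0_subgroup : is_subgroup heis_a0.
Proof.
split=> [|_ _ [b [c ->]] [b' [c' ->]]]; first by exists 0%R, 0%R; rewrite heis1.
by rewrite heisV heisM oppr0 addr0; eexists _, _.
Qed.

Lemma heis_center_subgroup : is_subgroup heis_center.
Proof.
split=> [|_ _ [c ->] [c' ->]]; first by exists 0%R; rewrite heis1.
by rewrite heisV heisM oppr0 addr0; eexists.
Qed.

Lemma heis_comm_center x y : heis_center [~ x, y].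
Proof.
have [a [b [c ->]]] := heis_surj x; have [a' [b' [c' ->]]] := heis_surj y.
by rewrite heis_comm; eexists.
Qed.

Lemma heis_lower2 : lower_central heisenberg 2 `<=` heis_center.
Proof.
apply: subgroup_gen_sub; first exact: heis_center_subgroup.
by move=> _ [x [y [_ _ ->]]]; apply: heis_comm_center.
Qed.

Lemma heis_lower3 : lower_central heisenberg 3 = [set 1].
Proof.
rewrite predeqE => x; split=> [|->]; last exact: (subgroup1 (lower_central_subgroup _ 3)).
apply: (subgroup_gen_sub (H := [set 1])).
  by split=> [//|_ _ -> ->]; rewrite /= mulgV.
move=> _ [y [z [/heis_lower2[c ->] _ ->]]] /=.
have [a [b [c' ->]]] := heis_surj z.
by rewrite heis_comm heis1 mul0r mulr0 subr0.
Qed.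

Lemma heis_step_length : has_step_length heisenberg 2.
Proof.
split=> //; first exact: heis_lower3.
case=> [//|[_ e|//]]; exfalso.
have : lower_central heisenberg 2 [~ heis 1 0 0, heis 0 1 0] by apply: lower_central_comm.
by rewrite e heis_comm heis1 => /heis_inj[_ _]; rewrite mulr1 mulr0 subr0.
Qed.

Lemma mem_gen_zpow (G : groupType) (K : set G) (x y k : G) (n : int) :
  K k -> y = (if n is Posz n then x ^+ n else x ^- `|n|%N) * k ->
  subgroup_gen (x |` K) y.
Proof.
move=> Kk ->; have sg := subgroup_gen_subgroup (x |` K).
have gx : subgroup_gen (x |` K) x by apply: sub_subgroup_gen; left.
apply: (subgroupM sg); last by apply: sub_subgroup_gen; right.
by case: n => n; [|apply: (subgroupV sg)]; apply: (subgroupX _ sg).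
Qed.

Lemma heis_zpow a b c (n : int) : (a * b = 0)%R ->
  (if n is Posz n then heis a b c ^+ n else heis a b c ^- `|n|%N) =
  heis (a * n) (b * n) (c * n).
Proof.
move=> ab0; have mulzn (d : int) m : (d *+ m = d * m%:Z)%R by rewrite -mulr_natr natz.
case: n => n; rewrite heisX0 // ?heisV !mulzn //.
by congr heis; rewrite ?NegzE; nia.
Qed.

Lemma heis_gen_step (H K : set heisenberg) x : is_subgroup H -> K `<=` H -> H x ->
  (forall y, H y -> exists n : int, exists2 k, K k &
    y = (if n is Posz n then x ^+ n else x ^- `|n|%N) * k) ->
  H = subgroup_gen (x |` K).
Proof.
move=> sH KH Hx dec; rewrite predeqE => y; split=> [/dec[n [k Kk]]|].
  exact: mem_gen_zpow.
by apply: subgroup_gen_sub => // z [->|/KH].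
Qed.

(** The subgroups [a = 0] and [a = b = 0] of the series are normal because they
    contain all commutators. *)
Lemma heis_hirsch_length : has_hirsch_length heisenberg 3.
Proof.
have nJ (H K : set heisenberg) : is_subgroup K -> K `<=` H ->
    (forall k c, K k -> K (k * heis 0 0 c)) -> normal_subgroup K H.
  move=> sK KH Kz; split=> // x k _ Kk; have [c e] := heis_comm_center k x.
  by rewrite -(mulVKg k (k ^ x)) -commgEl e; apply: Kz.
have pos (n : nat) : (0 < n)%N -> Posz n <> 0%R by case: n.
apply: (hirsch_infinite (K := heis_a0) (x := heis 1 0 0)) => //.
- apply: nJ => //; first exact: heis_a0_subgroup.
  by move=> _ x [b [c ->]]; rewrite heisM !addr0; eexists _, _.
- apply: heis_gen_step => // y _; have [a [b [c ->]]] := heis_surj y.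
  exists a, (heis 0 b (c - a * b)); first by eexists _, _.
  by rewrite heis_zpow ?mulr0 // heisM; congr heis; ring.
- move=> n /pos n0 [b [c]]; rewrite heisX0 ?mulr0 // => /heis_inj[].
  by rewrite -mulr_natr natz mul1r.
apply: (hirsch_infinite (K := heis_center) (x := heis 0 1 0)) => //.
- exact: heis_a0_subgroup.
- apply: nJ => //; first exact: heis_center_subgroup.
    by move=> _ [c ->]; eexists _, _.
  by move=> _ x [c ->]; rewrite heisM !addr0; eexists.
- apply: heis_gen_step => [||| _ [b [c ->]]].
  + exact: heis_a0_subgroup.
  + by move=> _ [c ->]; eexists _, _.
  + by eexists _, _.
  exists b, (heis 0 0 c); first by eexists.
  by rewrite heis_zpow ?mul0r // heisM; congr heis; ring.
- move=> n /pos n0 [c]; rewrite heisX0 ?mul0r // => /heis_inj[_].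
  by rewrite -mulr_natr natz mul1r.
apply: (hirsch_infinite (K := [set 1]) (x := heis 0 0 1)) => //; last exact: hirsch_trivial.
- exact: heis_center_subgroup.
- split; first by split=> [//|_ _ -> ->]; rewrite /= mulgV.
    by move=> _ ->; apply: (subgroup1 heis_center_subgroup).
  by move=> x _ _ ->; rewrite /= conj1g.
- apply: heis_gen_step => [||| _ [c ->]].
  + exact: heis_center_subgroup.
  + by move=> _ ->; apply: (subgroup1 heis_center_subgroup).
  + by eexists.
  exists c, 1 => //.
  by rewrite heis_zpow ?mul0r // mulg1 mul1r.
- move=> n /pos n0; rewrite heisX0 ?mul0r // heis1 => /heis_inj[_ _].
  by rewrite -mulr_natr natz mul1r.
Qed.

Lemma heis_filiform : finitely_generated heisenberg -> filiform heisenberg 3.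
Proof.
move=> fg; split; split=> //.
- exact: heis_torsion_free.
- by exists 2%N; apply: heis_lower3.
- exact: heis_hirsch_length.
- exact: heis_step_length.
Qed.

End Heisenberg.

(** * Word length and residual finiteness growth *)

Section Words.
Variables (G : groupType) (S : seq G).
Hypothesis genS : generates S.

Definition sym_seq : seq G := S ++ [seq x^-1 | x <- S].

Lemma mem_sym_seq x : (x \in sym_seq) = (x \in S) || (x^-1 \in S).
Proof. by rewrite mem_cat -[x in X in _ || X]invgK mem_map //; apply: invg_inj. Qed.

Lemma generates_word g : exists2 w : seq G,
  {subset w <= sym_seq} & \prod_(x <- w) x = g.
Proof.
have : subgroup_gen [set` S] g by rewrite genS.
move: g; apply: (subgroup_gen_sub (H := [set g | exists2 w : seq G,
  {subset w <= sym_seq} & \prod_(x <- w) x = g])) => [|g Sg]; last first.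
  exists [:: g]; last by rewrite big_seq1.
  by move=> y; rewrite inE => /eqP ->; rewrite mem_sym_seq Sg.
apply: is_subgroup_intro => [|_ _ [v vS <-] [w wS <-]|_ [w wS <-]].
- by exists [::]; rewrite ?big_nil.
- exists (v ++ w); last by rewrite big_cat.
  by move=> y; rewrite mem_cat => /orP[/vS|/wS].
- exists (rev [seq x^-1 | x <- w]).
    move=> y; rewrite mem_rev => /mapP[x /wS]; rewrite !mem_sym_seq => + ->.
    by rewrite invgK orbC.
  elim: w {wS} => [|x w IHw]; first by rewrite !big_nil invg1.
  by rewrite /= rev_cons -cats1 big_cat big_seq1 big_cons invMg -IHw.
Qed.

Lemma word_length_le (w : seq G) : {subset w <= sym_seq} ->
  (word_length S (\prod_(x <- w) x)%g <= size w)%N.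
Proof.
move=> wS; have [] := @nat_min_le [set n | exists v : seq G,
  [/\ size v = n, {in v, forall x, (x \in S) || (x^-1 \in S)} &
      \prod_(x <- v) x = \prod_(x <- w) x]] (size w) _ => //.
by exists w; split=> // x /wS; rewrite mem_sym_seq.
Qed.

Lemma word_length_word g : exists w : seq G, [/\ {subset w <= sym_seq},
  size w = word_length S g & \prod_(x <- w) x = g].
Proof.
have [w wS ew] := generates_word g.
have [] := @nat_min_le [set n | exists v : seq G,
  [/\ size v = n, {in v, forall x, (x \in S) || (x^-1 \in S)} &
      \prod_(x <- v) x = g]] (size w) _.
  by exists w; split=> // x /wS; rewrite mem_sym_seq.
move=> [v [sizev vS ev]] _; exists v; split=> // x xv.
by rewrite mem_sym_seq vS.
Qed.

Lemma word_lengthX g n : (word_length S (g ^+ n) <= n * word_length S g)%N.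
Proof.
have [w [wS <- <-]] := word_length_word g.
have -> : (\prod_(x <- w) x) ^+ n = \prod_(x <- flatten (nseq n w)) x.
  elim: n => [|n IHn]; first by rewrite big_nil.
  by rewrite expgS IHn /= big_cat.
apply: leq_trans (word_length_le _) _; last first.
  by rewrite size_flatten /shape map_nseq sumn_nseq mulnC.
by move=> y /flattenP[v]; rewrite mem_nseq => /andP[_ /eqP ->]; apply: wS.
Qed.

End Words.

Lemma nat_max_bounded (A : set nat) B : (forall q, A q -> (q <= B)%N) ->
  (nat_max A <= B)%N /\ forall q, A q -> (q <= nat_max A)%N.
Proof.
move=> AB; rewrite /nat_max; case: xgetP => [m _ [Am ubm]|none].
  by split=> [|q Aq]; [apply: AB | apply: ubm].
have noA q : ~ A q.
  move=> Aq.
  have exA : exists n, `[< A n >] by exists q; apply/asboolP.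
  have bndA n : `[< A n >] -> (n <= B)%N by move/asboolP; apply: AB.
  case: (ex_maxnP exA bndA) => m /asboolP Am maxm; apply: (none m); split=> // n An.
  exact/maxm/asboolP.
by split=> // q /noA.
Qed.

Section Divisibility.
Variables (G : groupType) (h : nat) (S : seq G).
Hypotheses (filG : filiform G h) (genS : generates S).

Lemma divisibility_le_log : exists A : nat, forall n y,
  (A * n.+1 ^ A < 2 ^ y)%N -> forall g : G, g <> 1 -> (word_length S g <= n)%N ->
  (divisibility g <= A * y.+1 ^ h)%N /\
  exists (Q : finGroupType) (phi : {multiplicative G -> Q}),
    #|Q| = divisibility g /\ phi g <> 1.
Proof.
have [[_ _ [c nilG]] [_ hirG _]] := filG.
have [A hA] := divisibility_upper nilG hirG (sym_seq S).
exists A => n y lt_y g g1 le_n.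
have [w [wS sizew ew]] := word_length_word genS g.
rewrite -ew in g1 *.
have [|Q [phi [leQ nphi]]] := hA w y wS g1.
  apply: leq_ltn_trans lt_y; rewrite leq_mul2l; apply/orP; right.
  by case: (A) => // A'; rewrite leq_exp2r // ltnS sizew.
have [[Q' [phi' [eQ' nphi']]] le_div] := @nat_min_le [set q | exists (Q : finGroupType)
  (phi : {multiplicative G -> Q}), #|Q| = q /\ phi (\prod_(x <- w) x) <> 1] #|Q|
  (ex_intro _ Q (ex_intro _ phi (conj erefl nphi))).
split; first exact: leq_trans le_div leQ.
by exists Q', phi'.
Qed.

(** The upper bound on all the values also shows that their maximum is attained, hence
    is at least each of them. *)
Lemma residual_finiteness_bounds : exists A : nat, forall n y,
  (A * n.+1 ^ A < 2 ^ y)%N ->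
  (residual_finiteness S n <= A * y.+1 ^ h)%N /\
  forall g : G, g <> 1 -> (word_length S g <= n)%N ->
    (divisibility g <= residual_finiteness S n)%N.
Proof.
have [A hA] := divisibility_le_log.
exists A => n y lt_y.
have [|le_max max_ge] := @nat_max_bounded [set divisibility g |
    g in [set g : G | g <> 1 /\ (word_length S g <= n)%N]] (A * y.+1 ^ h).
  by move=> _ [g [g1 le_n] <-]; have [] := hA n y lt_y g g1 le_n.
split=> // g g1 le_n; apply: max_ge.
by exists g.
Qed.

(** Take for [z] a nontrivial commutator of length [c = h - 1]. A finite quotient that
    does not kill [z ^+ lcm_upto m] gives [z] an order that is not a divisor of
    [lcm_upto m], hence is greater than [m], and so has more than
    [m ^ c.+1 = m ^ h] elements. *)
Lemma filiform_deep_element : exists z : G, forall m, (0 < m)%N ->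
  z ^+ lcm_upto m <> 1 /\ (m ^ h <= divisibility (z ^+ lcm_upto m))%N.
Proof.
have [[torG _ _] [h3 _ [c0 nilG minc]]] := filG.
have eh : h = h.-1.+1 by rewrite prednK // (leq_trans _ h3).
set c := h.-1 in eh c0 nilG minc.
have c2 : (2 <= c)%N by rewrite -ltnS -eh.
have gc : lower_central G c <> [set 1].
  move=> e; have c1 : (0 < c.-1)%N by rewrite -ltnS prednK.
  by have := minc _ c1; rewrite prednK // => /(_ e); rewrite leqNgt prednK ?leqnn.
have [y1 [[|y2 ys] [eqc z1]]] := nontrivial_simple_comm nilG c0 gc.
  by rewrite -eqc in c2.
set z := iter_comm y1 (y2 :: ys) in z1.
exists z => m m0.
have zL : z ^+ lcm_upto m <> 1 by move=> /torG e; apply/z1/e/lcm_upto_gt0.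
split=> //.
have [A hA] := divisibility_le_log.
have [Q [phi [<- nphi]]] := (hA (word_length S (z ^+ lcm_upto m))
   (A * (word_length S (z ^+ lcm_upto m)).+1 ^ A)%N (ltn_expl _ (ltnSn 1)) _ zL (leqnn _)).2.
have lt_m : (m < #[phi z])%N.
  rewrite ltnNge; apply/negP => le_m; apply: nphi.
  rewrite multX; apply/eqP; rewrite -order_dvdn.
  by rewrite dvdn_lcm_upto // order_gt0.
rewrite eh; apply: leq_trans (card_image_lower nilG phi y1 y2 (eqc : 2 + size ys = c)%N).
by rewrite leq_exp2r // ltnW.
Qed.

End Divisibility.

(** * Comparison with powers of the logarithm *)

Local Open Scope ring_scope.

Section Growth.
Variable R : realType.

Lemma ln2_ge_half : 1 / 2 <= ln 2 :> R.
Proof.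
have : ln (2^-1) <= - (1 / 2) :> R.
  have := @le_ln1Dx R (- (1 / 2)); rewrite (_ : 1 + _ = 2^-1); last by lra.
  by apply; lra.
by rewrite lnV ?posrE //; lra.
Qed.

Lemma ln2_le1 : ln 2 <= 1 :> R.
Proof. by have := @le_ln1Dx R 1; rewrite (_ : 1 + 1 = 2) //; apply; lra. Qed.

Lemma ln_nat_le (m n : nat) : (0 < m)%N -> (m <= n)%N -> ln m%:R <= ln n%:R :> R.
Proof.
move=> m0 le_mn; rewrite ler_ln ?posrE ?ltr0n ?ler_nat //.
exact: leq_trans le_mn.
Qed.

Lemma ln_natX (m k : nat) : (0 < m)%N -> ln (m ^ k)%:R = k%:R * ln m%:R :> R.
Proof. by move=> m0; rewrite natrX lnXn ?ltr0n // mulr_natl. Qed.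

Variables (G : groupType) (h : nat) (S : seq G).
Hypotheses (filG : filiform G h) (genS : generates S).

Lemma growth_upper :
  growth_le (fun n => (residual_finiteness S n)%:R : R) (fun n => ln n%:R ^+ h).
Proof.
have [A hA] := residual_finiteness_bounds filG genS.
(* The first summand makes [ln (C * n)] at least 1 and at least a multiple of the
   number of bits of the length bound; the second is the factor of the power. *)
pose C := (4 * A.+1 + A * (2 * A + 2) ^ h)%N.
exists C; first by rewrite /C; lia.
move=> n n0; pose T := trunc_log 2 (A * n.+1 ^ A).
have lt_T : (A * n.+1 ^ A < 2 ^ T.+1)%N by apply: trunc_log_ltn.
have le_T : (2 ^ T <= (4 * A.+1 * n) ^ A)%N.
  have [A0|Apos] := posnP A; first by rewrite /T A0 mul0n trunc_log0 expn0.
  apply: leq_trans (trunc_logP (ltnSn 1) _) _; first by rewrite muln_gt0 Apos expn_gt0.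
  apply: leq_trans (_ : A.+1 ^ A * (4 * n) ^ A <= _)%N; last first.
    by rewrite -expnMn leq_exp2r // mulnCA mulnA.
  apply: leq_mul; last by rewrite leq_exp2r //; lia.
  by apply: leq_trans (leq_pexp2l _ Apos) => //; rewrite expn1.
set X := ln (C * n)%:R : R.
have X1 : 1 <= X.
  apply: le_trans (_ : ln 4%:R <= _); last by apply: ln_nat_le => //; rewrite /C; nia.
  by rewrite (_ : 4%N = 2 ^ 2)%N // ln_natX //; have := ln2_ge_half; lra.
have TX : T%:R <= (2 * A)%:R * X :> R.
  have : T%:R * ln 2%:R <= A%:R * X.
    rewrite -ln_natX //; apply: le_trans (_ : ln ((4 * A.+1 * n) ^ A)%:R <= _).
      by apply: ln_nat_le => //; rewrite expn_gt0.
    rewrite ln_natX; last by rewrite !muln_gt0.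
    rewrite ler_wpM2l //; apply: ln_nat_le; first by rewrite !muln_gt0.
    by rewrite leq_mul2r /C leq_addr orbT.
  have : T%:R * (1 / 2) <= T%:R * ln 2%:R :> R by rewrite ler_wpM2l //; exact: ln2_ge_half.
  by rewrite natrM; lra.
have [le_F _] := hA n T.+1 lt_T.
apply: le_trans (_ : (A * T.+2 ^ h)%:R <= _); first by rewrite ler_nat.
rewrite natrM natrX.
have le_T2 : T.+2%:R <= (2 * A + 2)%:R * X :> R.
  by rewrite -[T.+2]addn2 natrD [(2 * A + 2)%:R]natrD mulrDl; lra.
apply: le_trans (_ : A%:R * ((2 * A + 2)%:R * X) ^+ h <= _).
  by rewrite ler_wpM2l // lerXn2r ?nnegrE // (le_trans _ le_T2).
rewrite exprMn mulrA -natrX -natrM ler_wpM2r //; first by rewrite exprn_ge0 //; lra.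
by rewrite ler_nat /C leq_addl.
Qed.

Lemma growth_lower :
  growth_le (fun n => ln n%:R ^+ h) (fun n => (residual_finiteness S n)%:R : R).
Proof.
have [z hz] := filiform_deep_element filG genS.
have [A hA] := residual_finiteness_bounds filG genS.
(* The first summand makes the words for [z ^+ lcm_upto m] short enough, and
   [ln n <= 4 * m] for the chosen power of two [m] gives the second. *)
pose C := ((word_length S z).+1 + 4 ^ h)%N.
exists C => // n n0.
have [k [le_k lt_k]] : exists k, (4 ^ (2 ^ k) <= 4 * n /\ 4 * n < 4 ^ (2 ^ k.+1))%N.
  have ex : exists k, (4 ^ (2 ^ k) <= 4 * n)%N by exists 0%N; rewrite expn0; lia.
  have bnd k : (4 ^ (2 ^ k) <= 4 * n)%N -> (k <= 4 * n)%N.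
    move=> le; apply: leq_trans le; apply: ltnW.
    by apply: ltn_trans (ltn_expl _ (ltnSn 1)) _; rewrite ltn_expl.
  case: (ex_maxnP ex bnd) => k hk maxk; exists k; split=> //.
  by rewrite ltnNge; apply/negP => /maxk; rewrite ltnn.
have m0 : (0 < 2 ^ k)%N by rewrite expn_gt0.
have [zL le_div] := hz _ m0.
have lcm_n : (lcm_upto (2 ^ k) <= n)%N.
  by rewrite -(leq_pmul2l (isT : 0 < 4)%N) (leq_trans (lcm_upto_exp2 k)).
have [_ le_F] := hA (C * n)%N _ (ltn_expl (A * (C * n).+1 ^ A) (ltnSn 1)).
have {le_F} le_F : ((2 ^ k) ^ h <= residual_finiteness S (C * n))%N.
  apply: leq_trans le_div (le_F _ zL _).
  apply: leq_trans (word_lengthX genS _ _) _.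
  rewrite mulnC leq_mul // /C; lia.
have ln_n : ln n%:R <= 4 * (2 ^ k)%:R :> R.
  apply: le_trans (_ : ln (4 ^ (2 ^ k.+1))%:R <= _).
    by apply: ln_nat_le => //; lia.
  rewrite -[4%N]/(2 ^ 2)%N -expnM ln_natX // expnS mulnA natrM.
  rewrite -[X in _ <= X]mulr1 ler_pM ?mulr_ge0 ?ler0n //.
  - by have := ln2_ge_half; lra.
  - exact: ln2_le1.
apply: le_trans (_ : (4 * (2 ^ k)%:R) ^+ h <= _).
  by rewrite lerXn2r ?nnegrE ?mulr_ge0 ?ln_ge0 ?ler1n.
rewrite exprMn -!natrX ler_pM ?ler_nat //.
by rewrite /C leq_addl.
Qed.

Lemma filiform_growth :
  growth_eq (fun n => (residual_finiteness S n)%:R : R) (fun n => ln n%:R ^+ h).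
Proof. by split; [exact: growth_upper | exact: growth_lower]. Qed.

End Growth.

Theorem corollary8p4 (R : realType) :
  (forall (N : groupType) (h : nat), filiform N h ->
     forall S : seq N, generates S ->
       growth_eq (fun n => (residual_finiteness S n)%:R : R)
                 (fun n => ln n%:R ^+ h)) /\
  (forall S : seq heisenberg, generates S ->
     growth_eq (fun n => (residual_finiteness S n)%:R : R)
               (fun n => ln n%:R ^+ 3)).
Proof.
split=> [N h filN S genS|S genS]; first exact: filiform_growth.
by apply: filiform_growth => //; apply: heis_filiform; exists S.
Qed.
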